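(* Let $2\le p<\infty$, $n\ge1$ and $Q=n+2\ge3$. Then for every $u\in C_0^\infty(B_1^Q(o)\setminus\{o\})$, $$\int_{B_1^Q(o)}\frac{|\nabla_{\varrho,G}u(x,t)|^p}{\varrho^{Q-p}(x,t)}\,dx\,dt-\left(\frac{p-1}{p}\right)^p\int_{B_1^Q(o)}\frac{|u(x,t)|^p|\nabla_G\varrho(x,t)|^p}{\varrho^Q(x,t)\big(\ln\frac1{\varrho(x,t)}\big)^p}\,dx\,dt\ \ge\ c_p\left(\frac{p-1}{p}\right)^p\sup_{R>0}d_C(u,R)^p,$$ where $c_p=\min_{0<\tau<1/2}\big[(1-\tau)^p-\tau^p+p\tau^{p-1}\big]$ and $$d_C(u,R)=\left(\int_{B_1^Q(o)}\frac{\Big|u(x,t)-\big(\ln\frac1{\varrho(x,t)}\big)^{\frac{p-1}{p}}R^{\frac{p-1}{p}}\,u\big(e^{-\frac1R}\tfrac{x}{\varrho(x,t)},e^{-\frac2R}\tfrac{t}{\varrho^2(x,t)}\big)\Big|^p}{\varrho^Q(x,t)\big(\ln\frac1{\varrho(x,t)}\big)^p\,\big|\ln\big(R\ln\frac1{\varrho(x,t)}\big)\big|^p}\,|\nabla_G\varrho(x,t)|^p\,dx\,dt\right)^{1/p}.$$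
   Context: Grushin space $G=\mathbb{R}^{n+1}$: points $(x,t)$ with $x\in\mathbb{R}^n$, $t\in\mathbb{R}$; origin $o=(\vec 0,0)$; homogeneous dimension $Q=n+2$; homogeneous norm $\varrho(x,t)=(|x|^4+4t^2)^{1/4}$; gauge ball $B_R^Q(o)=\{(x,t):\varrho(x,t)<R\}$; Grushin gradient $\nabla_G=(\nabla_x,|x|\partial_t)$, so that $|\nabla_G\varrho|^2=|x|^2/\varrho^2=:\psi$ away from $o$. Polar coordinates $(\varrho,\phi,w)$: $x=\varrho\sin^{1/2}\!\phi\;w$, $w\in\mathbb{S}^{n-1}$, $t=\frac{\varrho^2}{2}\cos\phi$, $0<\phi<\pi$. $\partial_\varrho$ is the partial derivative in $\varrho$ in these coordinates, i.e. $\partial_\varrho u=\frac1\varrho(x\cdot\nabla_xu+2t\,\partial_tu)$. Radial Grushin gradient: $\nabla_{\varrho,G}u=\psi^{1/2}(\partial_\varrho u,0,0)$, so $|\nabla_{\varrho,G}u|=\psi^{1/2}|\partial_\varrho u|$. $C_0^\infty$ denotes smooth compactly supported real-valued functions. *)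

(* Defs.v *)
From HB Require Import structures.
From mathcomp Require Import all_boot all_order all_algebra.
From mathcomp Require Import all_classical all_reals all_analysis.
From mathcomp Require Import ring lra.

Set Implicit Arguments.
Unset Strict Implicit.
Unset Printing Implicit Defensive.
Import Order.TTheory GRing.Theory Num.Theory.
Import numFieldNormedType.Exports.
Local Open Scope classical_set_scope.
Local Open Scope ring_scope.

(* The library has no sigma-algebra on ['rV[R]_n]: we take the product one,
   generated by the coordinates, as the library does for tuples. *)
Section measurable_rV.
Context {R : realType}.
Variable n : nat.

Definition rV_coord (i : 'I_n) (v : 'rV[R]_n) : R := v ord0 i.

Let rV_set0 : g_sigma_preimage rV_coord set0.
Proof. exact: sigma_algebra0. Qed.

Let rV_setC A : g_sigma_preimage rV_coord A -> g_sigma_preimage rV_coord (~` A).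
Proof. exact: sigma_algebraC. Qed.

Let rV_bigcup (F : _^nat) : (forall i, g_sigma_preimage rV_coord (F i)) ->
  g_sigma_preimage rV_coord (\bigcup_i (F i)).
Proof. exact: sigma_algebra_bigcup. Qed.

HB.instance Definition _ := @isMeasurable.Build default_measure_display
  'rV[R]_n (g_sigma_preimage rV_coord) rV_set0 rV_setC rV_bigcup.

Lemma measurable_rV_coord i : measurable_fun [set: 'rV[R]_n] (rV_coord i).
Proof.
move=> _ Y mY; rewrite setTI; apply: sub_sigma_algebra => /=.
rewrite -bigcup_seq/=; exists i => /=; first by rewrite mem_index_enum.
by exists Y => //; rewrite setTI.
Qed.

Lemma measurable_fun_rV d (T : measurableType d) (f : T -> 'rV[R]_n) :
  (forall i, measurable_fun [set: T] (rV_coord i \o f)) ->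
  measurable_fun [set: T] f.
Proof.
move=> mf.
have sub : g_sigma_preimage (fun i => rV_coord i \o f) `<=` measurable.
  apply: smallest_sub; first exact: sigma_algebra_measurable.
  move=> A; rewrite -bigcup_seq/= => -[i _ [B mB <-]].
  exact: mf.
rewrite g_sigma_preimage_comp in sub.
by move=> _ A mA; apply: sub; exists A.
Qed.

End measurable_rV.

Section lebesgue_rV.
Context {R : realType}.

Definition rV_cons n (p : R * 'rV[R]_n) : 'rV[R]_n.+1 :=
  \row_i (if unlift ord0 i is Some j then p.2 ord0 j else p.1).

(* Lebesgue measure on [R^n], as an iterated product measure. *)
Fixpoint lebesgue_rV n : set 'rV[R]_n -> \bar R :=
  match n with
  | 0 => \d_(0 : 'rV[R]_0)
  | m.+1 => pushforward (@lebesgue_measure R \x @lebesgue_rV m)%E (@rV_cons m)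
  end.

Lemma rV_cons0 n (p : R * 'rV[R]_n) : rV_cons p ord0 ord0 = p.1.
Proof. by rewrite mxE unlift_none. Qed.

Lemma rV_consS n (p : R * 'rV[R]_n) (i : 'I_n) :
  rV_cons p ord0 (lift ord0 i) = p.2 ord0 i.
Proof. by rewrite mxE liftK. Qed.

Lemma rV_cons_surj n (v : 'rV[R]_n.+1) : exists p, rV_cons p = v.
Proof.
exists (v ord0 ord0, \row_i v ord0 (lift ord0 i)); apply/rowP => i.
by case: (unliftP ord0 i) => [j|] ->; rewrite ?rV_consS ?rV_cons0 ?mxE.
Qed.

Lemma rV_cons_inj n : injective (@rV_cons n).
Proof.
move=> [x v] [y w] /rowP e; congr pair.
  by have := e ord0; rewrite !rV_cons0.
by apply/rowP => i; have := e (lift ord0 i); rewrite !rV_consS.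
Qed.

Lemma measurable_rV_cons n : measurable_fun setT (@rV_cons n).
Proof.
apply: measurable_fun_rV => i; case: (unliftP ord0 i) => [j|] ->.
  rewrite (_ : _ \o _ = rV_coord j \o snd).
    exact: measurableT_comp (measurable_rV_coord j) measurable_snd.
  by apply/funext => p; rewrite /rV_coord /= rV_consS.
rewrite (_ : _ \o _ = fst); first exact: measurable_fst.
by apply/funext => p; rewrite /rV_coord /= rV_cons0.
Qed.

Lemma measurable_rV_uncons n : measurable_fun setT
  (fun v : 'rV[R]_n.+1 => (v ord0 ord0, \row_i v ord0 (lift ord0 i))).
Proof.
apply: measurable_fun_pair => /=; first exact: measurable_rV_coord.
apply: measurable_fun_rV => i.
rewrite (_ : _ \o _ = rV_coord (lift ord0 i)).
  exact: measurable_rV_coord.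
by apply/funext => v; rewrite /rV_coord /= mxE.
Qed.

Section step.
Variables (n : nat) (mu : {sigma_finite_measure set 'rV[R]_n -> \bar R}).

Let nu := (@lebesgue_measure R \x mu)%E.
Let step := pushforward nu (@rV_cons n).

Let step0 : step set0 = 0%E.
Proof.
by rewrite /step /pushforward preimage_set0 -[RHS](measure0 (@lebesgue_measure R \x mu)%E).
Qed.

Let step_ge0 A : (0 <= step A)%E. Proof. exact: (measure_ge0 (@lebesgue_measure R \x mu)%E). Qed.

Let step_sigma_additive : semi_sigma_additive step.
Proof. by apply: measure_semi_sigma_additive; exact: measurable_rV_cons. Qed.

HB.instance Definition _ := isMeasure.Build _ _ _ step
  step0 step_ge0 step_sigma_additive.

Let nu_sigma_finite : sigma_finite setT nu.
Proof.
have /sigma_finiteP[F [TF ndF Foo]] := sigma_finiteT (@lebesgue_measure R).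
have /sigma_finiteP[G [TG ndG Goo]] := sigma_finiteT mu.
exists (fun n => F n `*` G n).
  rewrite -setXTT TF TG predeqE => -[x y]; split.
    move=> [/= [a _ Fax] [b _ Gby]]; exists (maxn a b) => //; split.
    - by move: x Fax; exact/subsetPset/ndF/leq_maxl.
    - by move: y Gby; exact/subsetPset/ndG/leq_maxr.
  by move=> [a _ []/= ? ?]; split; exists a.
move=> k; have [? ?] := Foo k; have [? ?] := Goo k.
split; first exact: measurableX.
by rewrite /nu product_measure1E// lte_mul_pinfty// ge0_fin_numE.
Qed.

Let step_sigma_finite : sigma_finite setT step.
Proof.
have [F TF Foo] := nu_sigma_finite.
pose g (v : 'rV[R]_n.+1) := (v ord0 ord0, \row_i v ord0 (lift ord0 i)).
have gK p : g (rV_cons p) = p.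
  case: p => x v; rewrite /g rV_cons0; congr pair.
  by apply/rowP => i; rewrite mxE rV_consS.
exists (fun k => g @^-1` F k).
  apply/esym; rewrite -preimage_bigcup -TF; exact: preimage_setT.
move=> k; have [mF Fk] := Foo k; split.
  by rewrite -[X in measurable X]setTI; exact: measurable_rV_uncons.
by rewrite /step /pushforward -comp_preimage (_ : g \o _ = id)//; apply/funext.
Qed.

HB.instance Definition _ := Measure_isSigmaFinite.Build _ _ _ step
  step_sigma_finite.

Lemma lebesgue_rV_step :
  exists m : {sigma_finite_measure set 'rV[R]_n.+1 -> \bar R}, step = m.
Proof. by exists step. Qed.

End step.

Lemma lebesgue_rV_sigma_finite_measure n :
  exists mu : {sigma_finite_measure set 'rV[R]_n -> \bar R},
    @lebesgue_rV n = mu.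
Proof.
elim: n => [|n [mu E]]; first by exists (dirac (0 : 'rV[R]_0)).
by have [m mE] := lebesgue_rV_step mu; exists m; rewrite /= E.
Qed.

Section lebesgue_rV_measure.
Variable n : nat.

Let lebesgue_rV0 : @lebesgue_rV n set0 = 0%E.
Proof.
by have [mu ->] := lebesgue_rV_sigma_finite_measure n; exact: measure0.
Qed.

Let lebesgue_rV_ge0 A : (0 <= @lebesgue_rV n A)%E.
Proof. by have [mu ->] := lebesgue_rV_sigma_finite_measure n. Qed.

Let lebesgue_rV_sigma_additive : semi_sigma_additive (@lebesgue_rV n).
Proof.
have [mu ->] := lebesgue_rV_sigma_finite_measure n.
exact: measure_semi_sigma_additive.
Qed.

HB.instance Definition _ := isMeasure.Build _ _ _ (@lebesgue_rV n)
  lebesgue_rV0 lebesgue_rV_ge0 lebesgue_rV_sigma_additive.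

Let lebesgue_rV_sigma_finite : sigma_finite setT (@lebesgue_rV n).
Proof.
have [mu ->] := lebesgue_rV_sigma_finite_measure n; exact: sigma_finiteT.
Qed.

HB.instance Definition _ := Measure_isSigmaFinite.Build _ _ _ (@lebesgue_rV n)
  lebesgue_rV_sigma_finite.

End lebesgue_rV_measure.

Lemma lebesgue_rV_box n (A : 'I_n -> set R) :
  (forall i, measurable (A i)) ->
  lebesgue_rV [set v : 'rV[R]_n | forall i, A i (v ord0 i)] =
  (\prod_(i < n) @lebesgue_measure R (A i))%E.
Proof.
elim: n A => [|n IH] A mA.
  rewrite big_ord0 /= diracE mem_set//; by case.
rewrite big_ord_recl /= -IH//.
have mB : measurable
    [set v : 'rV[R]_n | forall i, A (lift ord0 i) (v ord0 i)].
  rewrite (_ : [set _ | _] =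
      \big[setI/setT]_(i < n) (rV_coord i @^-1` A (lift ord0 i))).
    apply: bigsetI_measurable => i _.
    by rewrite -[X in measurable X]setTI; exact: measurable_rV_coord.
  rewrite -bigcap_seq; apply/seteqP; split => v /= h i.
    by move=> _; exact: h.
  by apply: (h i); rewrite /= mem_index_enum.
have := product_measure1E (@lebesgue_measure R) (@lebesgue_rV n) (mA ord0) mB.
move=> <-; rewrite /pushforward; congr (_ _); apply/seteqP; split => -[x v] /=.
  move=> h; split => [|i]; first by have := h ord0; rewrite rV_cons0.
  by have := h (lift ord0 i); rewrite rV_consS.
move=> [hx hv] i; case: (unliftP ord0 i) => [j|] ->.
  by rewrite rV_consS.
by rewrite rV_cons0.
Qed.

End lebesgue_rV.

Section grushin.
Context {R : realType} {n : nat}.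
Implicit Types (u f : 'rV[R]_n * R -> R) (z : 'rV[R]_n * R) (x : 'rV[R]_n).

(* The library norm on ['rV[R]_n] is the sup norm. *)
Definition enorm x : R := Num.sqrt (\sum_i x ord0 i ^+ 2).

Definition rho z : R := (enorm z.1 ^+ 4 + 4 * z.2 ^+ 2) `^ 4^-1.

Definition gauge_ball (r : R) : set ('rV[R]_n * R) := [set z | rho z < r].

Definition hom_dim : R := n%:R + 2.

Definition grad_x f z : 'rV[R]_n := \row_i 'D_(delta_mx ord0 i, 0) f z.

Definition partial_t f z : R := 'D_(0, 1) f z.

Definition grushin_grad f z : 'rV[R]_n * R :=
  (grad_x f z, enorm z.1 * partial_t f z).

Definition grushin_grad_norm f z : R :=
  Num.sqrt (enorm (grushin_grad f z).1 ^+ 2 + (grushin_grad f z).2 ^+ 2).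

(* Equals the square of [grushin_grad_norm rho] away from the origin. *)
Definition psi z : R := enorm z.1 ^+ 2 / rho z ^+ 2.

(* The derivative in [rho] at fixed [(phi, w)] in the polar coordinates
   [x = rho * sin(phi)^(1/2) * w], [t = rho^2 / 2 * cos(phi)], written in
   Cartesian coordinates by the chain rule. *)
Definition partial_rho f z : R :=
  (rho z)^-1 *
  (\sum_i z.1 ord0 i * grad_x f z ord0 i + 2 * z.2 * partial_t f z).

(* Euclidean norm of [psi^(1/2) * (partial_rho f, 0, 0)]. *)
Definition radial_grad_norm f z : R := Num.sqrt (psi z) * `|partial_rho f z|.

(* All iterated directional derivatives are Frechet differentiable. *)
Definition smooth u : Prop :=
  forall (vs : seq ('rV[R]_n * R)) z,
    differentiable (foldr (fun v g => ('D_v g : _ -> R)) u vs) z.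

Definition supp u : set ('rV[R]_n * R) := closure [set z | u z != 0].

(* A function in [C_0^oo(A)] is identified with its extension by zero. *)
Definition test_function (A : set ('rV[R]_n * R)) u : Prop :=
  [/\ smooth u, compact (supp u) & supp u `<=` A].

Definition lebesgue_grushin : set ('rV[R]_n * measurableTypeR R) -> \bar R :=
  (@lebesgue_rV R n \x @lebesgue_measure R)%E.

HB.instance Definition _ := Measure.on lebesgue_grushin.

Definition dC (p : R) u (r : R) : \bar R :=
  ((\int[lebesgue_grushin]_(z in gauge_ball 1)
     (`| u z - ln (rho z)^-1 `^ ((p - 1) / p) * r `^ ((p - 1) / p) *
               u ((expR (- r^-1) / rho z) *: z.1,
                  expR (- (2 / r)) * (z.2 / rho z ^+ 2)) | `^ p /
      (rho z `^ hom_dim * ln (rho z)^-1 `^ p *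
       `| ln (r * ln (rho z)^-1) | `^ p) *
      grushin_grad_norm rho z `^ p)%:E) `^ p^-1)%E.

End grushin.
Arguments hom_dim : clear implicits.
Arguments lebesgue_grushin : clear implicits.

Section constant.
Context {R : realType}.

Definition cp_fun (p tau : R) : R :=
  (1 - tau) `^ p - tau `^ p + p * tau `^ (p - 1).

(* The infimum is a minimum, see [cp_min]. *)
Definition cp (p : R) : R := inf [set cp_fun p tau | tau in `]0, 2^-1[].

Let is_derive_1B (t : R) : is_derive t 1 (fun x : R => 1 - x) (-1).
Proof.
have h := is_deriveB (is_derive_cst (1 : R) t 1) (is_derive_id t (1 : R)).
by apply: is_derive_eq h _; rewrite sub0r.
Qed.

Lemma is_derive_cp_fun (p t : R) : 0 < t < 1 ->
  is_derive t 1 (cp_fun p) (- (p * (1 - t) `^ (p - 1)) - p * t `^ (p - 1) +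
    p * ((p - 1) * t `^ (p - 1 - 1))).
Proof.
move=> /andP[t0 t1].
have t1' : 0 < 1 - t by rewrite subr_gt0.
have d1 := is_derive_1B t.
have d2 := @is_derive1_comp _ (fun x : R => x `^ p) (fun x : R => 1 - x) t _ _
  (is_derive1_powR p t1') d1.
have d3 := is_derive1_powR p t0.
have d4 := is_derive1_powR (p - 1) t0.
have d5 : is_derive t 1 (fun x : R => p * x `^ (p - 1))
    (p * ((p - 1) * t `^ (p - 1 - 1))) by apply: is_deriveZ.
have h := is_deriveD (is_deriveB d2 d3) d5.
by apply: is_derive_eq h _; rewrite mulrN1.
Qed.

Lemma cp_fun_continuous (p : R) : 2 <= p ->
  {within `[0, 2^-1], continuous (cp_fun p)}.
Proof.
move=> p2; have h0 : (0 : R) < 2^-1 by rewrite invr_gt0.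
have h1 : (2^-1 : R) < 1 by rewrite invf_lt1// ltr1n.
have cts t : 0 < t < 1 -> {for t, continuous (cp_fun p)}.
  move=> t01; apply: differentiable_continuous; apply/derivable1_diffP.
  by have [] := is_derive_cp_fun p t01.
apply/continuous_within_itvP => //; split.
- move=> t; rewrite in_itv/= => /andP[t0 t1]; apply: cts.
  by rewrite t0 (lt_trans t1).
- have c1 : (1 - t) `^ p @[t --> (0 : R)^'+] --> (1 - 0 : R) `^ p.
    apply: cvg_at_right_filter.
    have t1' : 0 < 1 - 0 :> R by lra.
    have d1 := is_derive_1B 0.
    have [d2 _] := @is_derive1_comp _ (fun x : R => x `^ p) (fun x : R => 1 - x) 0 _ _
      (is_derive1_powR p t1') d1.
    by move/derivable1_diffP : d2 => /differentiable_continuous.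
  have c2 : t `^ p @[t --> (0 : R)^'+] --> (0 : R) by apply: powR_cvg0; lra.
  have c3 : t `^ (p - 1) @[t --> (0 : R)^'+] --> (0 : R).
    by apply: powR_cvg0; lra.
  have pn0 : p != 0 by apply/eqP; lra.
  have pn1 : p - 1 != 0 by apply/eqP; lra.
  rewrite /cp_fun powR0// powR0//.
  by apply: cvgD; [exact: cvgB|apply: cvgMr].
- by apply: cvg_at_left_filter; apply: cts; rewrite h0.
Qed.

Lemma cp_min (p : R) : 2 <= p ->
  exists2 tau : R, tau \in `]0, 2^-1[ & cp p = cp_fun p tau /\
    forall t, t \in `]0, 2^-1[ -> cp_fun p tau <= cp_fun p t.
Proof.
move=> p2; have h0 : (0 : R) < 2^-1 by rewrite invr_gt0.
have h1 : (2^-1 : R) < 1 by rewrite invf_lt1// ltr1n.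
suff [tau tau0 taumin] : exists2 tau : R, tau \in `]0, 2^-1[ &
    forall t, t \in `]0, 2^-1[ -> cp_fun p tau <= cp_fun p t.
  exists tau => //; split => //; apply/eqP; rewrite eq_le; apply/andP; split.
    apply: ge_inf; last by exists tau.
    by exists (cp_fun p tau) => _ [t t0 <-]; exact: taumin.
  apply: lb_le_inf; first by exists (cp_fun p tau), tau.
  by move=> _ [t t0 <-]; exact: taumin.
have [p2'|pn2] := eqVneq p 2.
  have cst t : 0 < t < 2^-1 -> cp_fun p t = 1.
    move=> /andP[t0 t1]; have t2 : 0 <= 1 - t by move: t1 h1; lra.
    rewrite /cp_fun p2' (_ : 2 - 1 = 1 :> R); last by lra.
    by rewrite powRr1 ?ltW// !powR_mulrn// ?ltW//; ring.
  have q : 0 < (4^-1 : R) < 2^-1 by apply/andP; split; lra.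
  exists 4^-1; first by rewrite in_itv.
  by move=> t; rewrite in_itv/= => t0; rewrite !cst.
have {pn2}p2' : 2 < p by rewrite lt_neqAle eq_sym pn2.
have [c cI cmin] := EVT_min (ltW h0) (cp_fun_continuous p2).
have pn0 : p != 0 by apply/eqP; lra.
have pn1 : p - 1 != 0 by apply/eqP; lra.
have [c0|cn0] := eqVneq c 0.
  exfalso.
  have f0 : cp_fun p c = 1.
    by rewrite c0 /cp_fun subr0 powR1 !powR0// subr0 mulr0 addr0.
  have c3 : t `^ (p - 2) @[t --> (0 : R)^'+] --> (0 : R).
    by apply: powR_cvg0; lra.
  have pV : 0 < p^-1 by rewrite invr_gt0; lra.
  have near_t : \forall t \near (0 : R)^'+,
      [/\ t `^ (p - 2) < p^-1, 0 < t & t < 2^-1].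
    near=> t; split.
    - by near: t; exact: (cvgr_lt _ c3).
    - by near: t; exact: nbhs_right_gt.
    - by near: t; exact: nbhs_right_lt.
  have [t [ht t0 t1]] := @filter_ex _ _ (at_right_proper_filter _) _ near_t.
  suff : cp_fun p t < 1.
    rewrite ltNge; apply/negP; rewrite negbK -f0; apply: cmin.
    by rewrite in_itv/= !ltW.
  rewrite /cp_fun.
  have e1 : (1 - t) `^ p <= 1 - t.
    by apply: ge1r_powR; [apply/andP; split; lra|lra].
  have e2 : t `^ p > 0 by exact: powR_gt0.
  have e3 : p * t `^ (p - 1) < t.
    rewrite (_ : p - 1 = 1 + (p - 2)); last by ring.
    rewrite powRD; last by rewrite (gt_eqF t0) implybT.
    rewrite powRr1 ?ltW// mulrCA gtr_pMr// mulrC -ltr_pdivlMr ?div1r//.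
    lra.
  lra.
have [ch|cnh] := eqVneq c 2^-1.
  exfalso; rewrite {cI cn0}ch in cmin.
  have h01 : 0 < (2^-1 : R) < 1 by rewrite h0 h1.
  have [df vf] := is_derive_cp_fun p h01.
  have dpos : 0 < 'D_1 (cp_fun p) 2^-1.
    rewrite vf (_ : 1 - 2^-1 = 2^-1 :> R); last by lra.
    have -> : (2^-1 : R) `^ (p - 1) = 2^-1 * 2^-1 `^ (p - 1 - 1).
      by rewrite mulr_powRB1//; lra.
    have : 0 < (2^-1 : R) `^ (p - 1 - 1) by exact: powR_gt0.
    have q0 : 0 < p - 2 by lra.
    have q1 : 0 < p by lra.
    by move: (_ `^ _) => a a0; have := mulr_gt0 (mulr_gt0 q1 a0) q0; lra.
  have near_h : \forall h \near (0 : R)^'-, [/\ 0 < h^-1 *: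
      ((cp_fun p \o shift 2^-1) (h *: (1 : R)) - cp_fun p 2^-1), h < 0
      & - 2^-1 < h].
    near=> h; split.
    - by near: h; exact: (cvgr_gt _ (cvg_dnbhs_at_left df)).
    - by near: h; exact: nbhs_left_lt.
    - by near: h; apply: nbhs_left_gt; rewrite oppr_lt0.
  have [h [+ hlt hgt]] := @filter_ex _ _ (at_left_proper_filter _) _ near_h.
  rewrite /= [h *: 1]mulr1 [_ *: _]/(_ * _) => q0.
  have hI : h + 2^-1 \in `[(0 : R), 2^-1] by rewrite in_itv/=; lra.
  have := cmin _ hI; apply/negP; rewrite -ltNge -subr_lt0.
  by rewrite -(nmulr_rgt0 _ (_ : h^-1 < 0))// invr_lt0.
exists c.
  move: cI; rewrite !in_itv/= => /andP[a b].
  by rewrite !lt_neqAle a b eq_sym cn0 cnh.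
move=> t; rewrite in_itv/= => /andP[a b]; apply: cmin.
by rewrite in_itv/= !ltW.
Unshelve. all: by end_near. Qed.

End constant.

(* Main.v *)
Require Import Defs.
From HB Require Import structures.
From mathcomp Require Import all_boot all_order all_algebra.
From mathcomp Require Import all_classical all_reals all_analysis.
From mathcomp Require Import measurable_realfun ring lra.
Set Implicit Arguments.
Unset Strict Implicit.
Unset Printing Implicit Defensive.
Import Order.TTheory GRing.Theory Num.Theory.
Import numFieldNormedType.Exports.
Local Open Scope classical_set_scope.
Local Open Scope ring_scope.

(* Along a ray [s |-> dil (e^-s) w] with [rho w = 1] every integrand becomes a
   constant multiple of a function of [s = ln (1 / rho)], and the claim becomes
   an inequality for [g s = u (dil (e^-s) w)] on ]0, +oo[. Put
   [k = (p - 1) / p] and [g = s^k v]. The pointwise inequality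
   [|a + b|^p >= |a|^p + p |a|^(p-2) a b + cp |b|^p] with [a = k g / s] and
   [b = s^k v'] produces the Hardy term, an exact derivative, and
   [cp s^(p-1) |v'|^p]; in the variable [y = ln (r s)] the latter is
   [cp |dv/dy|^p dy], and the Hardy inequality for [v(y) - v(0)] on both sides
   of [y = 0] turns it into the integrand of [dC p u r ^ p].
   The rays are integrated against Lebesgue measure without polar coordinates,
   by averaging over dilations. *)

(** * The expansion of |a + b|^p with sharp remainder *)

(** The factor [cp * k^p] comes from using the expansion twice. The first use turns [|g'|^p] into
    the Hardy term, an exact derivative and [cp |b|^p]. The second applies it to [b = a2 + (b - a2)]
    and keeps only the leading term, [k^p] times the [dC] integrand, and the linear term, again an
    exact derivative. Thus the Hardy inequality in [y] is never stated on its own: both steps are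
    added pointwise in [s] and integrated once. The value subtracted in [dC] is forced by this. The
    primitive of the second exact derivative is, up to sign and constants,
    [|y|^(1-p) |v(y) - v(0)|^p], which would blow up at [y = 0] without the subtraction; [y = 0]
    means [s = 1 / r], and the rescaled argument of [u] in [dC] is the point of the same ray with
    that [s]. Even so the primitive is singular in form at [s = 1 / r], so this point is cut out and
    approached from both sides. The constant does not depend on [r], so the supremum follows from
    the inequality for each [r]. *)

Section power_inequalities.
Context {R : realType}.
Implicit Types (x y a b p q t : R).

Lemma powR_invr x p : 0 <= x -> x^-1 `^ p = (x `^ p)^-1.
Proof. by move=> x0; rewrite -powR_inv1// -powRrM mulN1r powRN. Qed.

(* Young's inequality for [y * x^(q - 1)] with exponents [q] and [q / (q - 1)]. *)
Lemma powR_tangent_le q x y : 1 <= q -> 0 <= x -> 0 <= y ->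
  x `^ q + q * x `^ (q - 1) * (y - x) <= y `^ q.
Proof.
move=> q1 x0 y0.
have [->|qn1] := eqVneq q 1.
  by rewrite subrr powRr0 !powRr1//; lra.
have q1' : 1 < q by rewrite lt_neqAle eq_sym qn1.
have x1 : 0 <= x `^ (q - 1) by exact: powR_ge0.
have q'0 : 0 < q / (q - 1) by apply: divr_gt0; lra.
have := @conjugate_powR R y (x `^ (q - 1)) q (q / (q - 1)) y0 x1 _ q'0.
rewrite -powRrM mulrCA divff ?mulr1; last by apply/eqP; lra.
have -> : q^-1 + (q / (q - 1))^-1 = 1.
  by field; apply/andP; split; apply/eqP; lra.
move=> /(_ _ erefl); rewrite (_ : 0 < q); last by lra.
move=> /(_ isT) h.
have xq : x `^ q = x * x `^ (q - 1) by rewrite mulr_powRB1//; lra.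
have q0 : 0 < q by lra.
have : q * (y * x `^ (q - 1)) <= q * (y `^ q / q + x `^ q / (q / (q - 1))).
  by rewrite ler_pM2l.
have -> : q * (y `^ q / q + x `^ q / (q / (q - 1))) = y `^ q + (q - 1) * x `^ q.
  by field; apply/andP; split; apply/eqP; lra.
by rewrite xq; nra.
Qed.

(** Each of [x^q], [y^q] is at most its base times [(x + y)^(q-1)], and the two bounds add up to
    [(x + y)^q]. *)
Lemma powRD_ge q x y : 1 <= q -> 0 <= x -> 0 <= y ->
  x `^ q + y `^ q <= (x + y) `^ q.
Proof.
move=> q1 x0 y0.
have aux a b : 0 <= a -> 0 <= b -> a `^ q <= a * (a + b) `^ (q - 1).
  move=> a0 b0; rewrite -(@mulr_powRB1 _ a q)//; last by lra.
  by rewrite ler_wpM2l// ge0_ler_powR ?nnegrE//; lra.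
rewrite -(@mulr_powRB1 _ (x + y) q); [|by lra|by lra].
by rewrite mulrDl lerD ?aux// addrC aux.
Qed.

(** The minimum [cp] is taken over an open interval; its two endpoints are added by continuity. The
    endpoint [0] yields [cp p <= 1]. *)
Lemma cp_le p t : 2 <= p -> 0 <= t <= 2^-1 -> cp p <= cp_fun p t.
Proof.
move=> p2 t01; have [s sI [-> smin]] := cp_min p2.
have h0 : (0 : R) < 2^-1 by lra.
have /(continuous_within_itvP _ h0)[_ c0 c1] := cp_fun_continuous p2.
case/andP: t01; rewrite le_eqVlt => /predU1P[<- _|t0].
  apply: (cvgr_to_ge c0); near=> x; apply: smin.
  by rewrite in_itv/=; apply/andP; split; near: x;
    [exact: nbhs_right_gt|exact: nbhs_right_lt].
rewrite le_eqVlt => /predU1P[->|t1].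
  apply: (cvgr_to_ge c1); near=> x; apply: smin.
  by rewrite in_itv/=; apply/andP; split; near: x;
    [exact: nbhs_left_gt|exact: nbhs_left_lt].
by apply: smin; rewrite in_itv/= t0.
Unshelve. all: by end_near. Qed.

Lemma cp_le1 p : 2 <= p -> cp p <= 1.
Proof.
move=> p2; have -> : 1 = cp_fun p 0.
  rewrite /cp_fun subr0 powR1 !powR0; [|apply/eqP; lra..].
  by rewrite subr0 mulr0 addr0.
by apply: cp_le => //; apply/andP; split; lra.
Qed.

Lemma cp_gt0 p : 2 <= p -> 0 < cp p.
Proof.
move=> p2; have [s + [-> _]] := cp_min p2; rewrite in_itv/= => /andP[s0 s1].
have : 0 < p * s `^ (p - 1) by apply: mulr_gt0; [lra|exact: powR_gt0].
have : s `^ p <= (1 - s) `^ p by apply: ge0_ler_powR; rewrite ?nnegrE; lra.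
by rewrite /cp_fun; lra.
Qed.

(* With [x = - t], the definition of [cp] covers [0 < t < 1/2]; the range
   [1/2 < t <= 1] reduces to it by [t |-> 1 - t], and elsewhere the bound is [1]. *)
Lemma cp_le_expansion p x : 2 <= p ->
  cp p <= `|1 + x| `^ p - `|x| `^ p - p * (x * `|x| `^ (p - 2)).
Proof.
move=> p2.
have x1E y : 0 <= y -> y * y `^ (p - 2) = y `^ (p - 1).
  move=> y0; rewrite -(@mulr_powRB1 _ y (p - 1))//; last by lra.
  by congr (_ * _ `^ _); lra.
have xpE y : 0 <= y -> y * y `^ (p - 1) = y `^ p.
  by move=> y0; rewrite mulr_powRB1//; lra.
have [x0|x0] := leP 0 x.
  rewrite !ger0_norm ?x1E//; last by lra.
  apply: (le_trans (cp_le1 p2)).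
  (* Split [(1 + x)^p] as [(1 + x)^(p-1) + x (1 + x)^(p-1)]. Superadditivity bounds the first
     summand below by [1 + x^(p-1)], the tangent inequality bounds the second by
     [x^p + (p - 1) x^(p-1)]. *)
  have q1 : 1 <= p - 1 by lra.
  have y0 : 0 <= 1 + x by lra.
  have := powR_tangent_le q1 x0 y0; have := powRD_ge q1 ler01 x0.
  rewrite powR1 -(xpE _ y0) -(xpE _ x0) (_ : p - 1 - 1 = p - 2); last by lra.
  have := powR_ge0 x (p - 2); have := powR_ge0 x (p - 1).
  rewrite -(x1E _ x0); move: (x `^ _) => A; move: ((1 + x) `^ _) => B; nra.
have [t xE] : exists t, x = - t by exists (- x); rewrite opprK.
have {x0}t0 : 0 < t by move: x0; rewrite xE; lra.
rewrite {}xE normrN (gtr0_norm t0) mulNr mulrN opprK (x1E _ (ltW t0)).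
have [t1|t1] := leP t 2^-1.
  rewrite ger0_norm; last by lra.
  by apply: cp_le => //; rewrite t1 ltW.
have [t2|t2] := leP t 1.
  rewrite ger0_norm; last by lra.
  have h : 0 <= 1 - t <= 2^-1 by apply/andP; split; lra.
  apply: (le_trans (cp_le p2 h)); rewrite /cp_fun opprB addrCA subrr addr0.
  case/andP: h => b0 _; have t0' := ltW t0.
  have := powR_ge0 t (p - 2); have := powR_ge0 (1 - t) (p - 2).
  have : (1 - t) `^ (p - 2) <= t `^ (p - 2).
    by apply: ge0_ler_powR; rewrite ?nnegrE; lra.
  rewrite -(xpE _ b0) -(xpE _ t0') -(x1E _ b0) -(x1E _ t0').
  (* With these [A] and [B], the right side minus the left side is [(p - 2) (t A - (1 - t) B) + 2 t
     (1 - t) (A - B)]; both summands are nonnegative. *)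
  move: (t `^ _) ((1 - t) `^ _) => A B AB B0 A0.
  have : (1 - t) * B <= t * A by apply: ler_pM => //; lra.
  have : 0 <= t * (1 - t) * (A - B) by apply: mulr_ge0; [apply: mulr_ge0|]; lra.
  nra.
have [z tE] : exists z, t = 1 + z by exists (t - 1); lra.
have {}t2 : 0 < z by move: t2; rewrite tE; lra.
rewrite {t1 t0}tE opprD addrA subrr add0r normrN (gtr0_norm t2).
apply: (le_trans (cp_le1 p2)).
have q1 : 1 <= p - 1 by lra.
have y0 : 0 <= 1 + z by lra.
(* The tangent at [1 + z], evaluated at [z] and multiplied by [z], bounds the expression below by
   [(p - 1) (1 + z)^(p-2)], which is at least [1]. *)
have := powR_tangent_le q1 y0 (ltW t2).
rewrite -(xpE _ y0) -(xpE _ (ltW t2)) (_ : p - 1 - 1 = p - 2); last by lra.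
rewrite -(x1E _ y0) => h.
have : 1 <= (1 + z) `^ (p - 2).
  by rewrite -[leLHS](powRr0 (1 + z)); apply: ler_powR; lra.
move: h; move: (z `^ _) ((1 + z) `^ _) => A B h B1.
have := ler_wpM2l (ltW t2) h.
have : 1 * 1 <= (p - 1) * B by apply: ler_pM; lra.
nra.
Qed.

(** By homogeneity of degree [p], this is [cp_le_expansion] at [x = a / b], multiplied by
    [|b|^p]. *)
Lemma powR_norm_expansion p a b : 2 <= p ->
  `|a| `^ p + p * (a * `|a| `^ (p - 2)) * b + cp p * `|b| `^ p <=
  `|a + b| `^ p.
Proof.
move=> p2; have [->|b0] := eqVneq b 0.
  rewrite normr0 powR0; last by apply/eqP; lra.
  by rewrite !mulr0 !addr0.
have nb : 0 < `|b| by rewrite normr_gt0.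
have Bp : 0 < `|b| `^ p by exact: powR_gt0.
have := cp_le_expansion (a / b) p2; rewrite -(ler_pM2l Bp).
have -> : 1 + a / b = (a + b) / b by rewrite mulrDl divff// addrC.
have nrmE x : `|b| `^ p * `|x / b| `^ p = `|x| `^ p.
  by rewrite -powRM// -normrM mulrCA divff// mulr1.
have -> : `|b| `^ p * (`|(a + b) / b| `^ p - `|a / b| `^ p -
    p * (a / b * `|a / b| `^ (p - 2))) =
    `|a + b| `^ p - `|a| `^ p - p * (a * `|a| `^ (p - 2)) * b.
  rewrite !mulrBr !nrmE; congr (_ - _).
  rewrite (_ : `|b| `^ p = b ^+ 2 * `|b| `^ (p - 2)); last first.
    rewrite -real_normK ?num_real// -powR_mulrn// -powRD; first by congr powR; lra.
    by rewrite (gt_eqF nb) implybT.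
  have -> : `|a| `^ (p - 2) = `|b| `^ (p - 2) * `|a / b| `^ (p - 2).
    by rewrite -powRM// -normrM mulrCA divff// mulr1.
  by field.
lra.
Qed.

End power_inequalities.

(** * Borel measurability on the Grushin space *)

(** For [g >= 0] the inverse is the real power with exponent [-1], a measurable function; the two
    conventions agree at [0], where both give [0]. *)
Lemma measurable_fun_divr d (T : measurableType d) (R : realType) (f g : T -> R) :
  (forall x, 0 <= g x) -> measurable_fun setT f -> measurable_fun setT g ->
  measurable_fun setT (fun x => f x / g x).
Proof.
move=> g0 mf mg; apply: measurable_funM => //.
rewrite (_ : (fun x => (g x)^-1) = (fun x => g x `^ (-1))).
  exact: measurableT_comp (measurable_powR _) mg.
by apply/funext => x; rewrite powR_inv1.
Qed.

Section grushin_measurability.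
Context {R : realType} {n : nat}.
Notation G := ('rV[R]_n * measurableTypeR R)%type.

Let box (q : 'rV[rat]_n * rat * nat) : set G :=
  [set z : G | (forall i, `|ratr (q.1.1 ord0 i) - z.1 ord0 i| < q.2.+1%:R^-1) /\
           `|ratr q.1.2 - z.2| < q.2.+1%:R^-1].

Lemma measurable_coord1 (i : 'I_n) : measurable_fun setT (fun z : G => z.1 ord0 i).
Proof.
exact: measurableT_comp (measurable_rV_coord i) measurable_fst.
Qed.

Let measurable_box q : measurable (box q).
Proof.
have mC (f : G -> R) (c e : R) : measurable_fun setT f ->
    measurable [set z : G | `|c - f z| < e].
  move=> mf.
  have mlt : measurable_fun setT (fun z : G => `|c - f z| < e).
    apply: measurable_fun_ltr; last exact: measurable_cst.
    by apply: measurableT_comp => //; exact: measurable_funB.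
  have -> : [set z : G | `|c - f z| < e] =
      (fun z : G => `|c - f z| < e) @^-1` [set true].
    by apply/seteqP; split.
  by rewrite -[X in measurable X]setTI; exact: mlt.
rewrite (_ : box q = (\big[setI/setT]_(i < n)
    [set z : G | `|ratr (q.1.1 ord0 i) - z.1 ord0 i| < q.2.+1%:R^-1]) `&`
    [set z : G | `|ratr q.1.2 - z.2| < q.2.+1%:R^-1]).
  apply: measurableI; last by apply: mC; exact: measurable_snd.
  by apply: bigsetI_measurable => i _; apply: mC; exact: measurable_coord1.
rewrite -bigcap_seq;  apply/seteqP; split => z /= [h1 h2]; split => // i.
  by move=> _; exact: h1.
by apply: (h1 i); rewrite /= mem_index_enum.
Qed.

(** An open set is the union of the rational boxes that it contains. There are countably many, and
    each is cut out by finitely many coordinate conditions, hence lies in the product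
    sigma-algebra. *)
Lemma open_measurable_grushin (U : set ('rV[R]_n * R)) : open U ->
  measurable (U : set G).
Proof.
move=> oU.
rewrite (_ : U = \bigcup_q (if `[< box q `<=` U >] then box q else set0)).
  apply: countable_bigcupT_measurable; first exact: countableP.
  by move=> q; case: ifP.
apply/seteqP; split => [z Uz|z [q _]]; last by case: ifPn => // /asboolP; exact.
have [e /= e0 zeU] : nbhs_ball z U by rewrite nbhs_ballE; exact: oU.
(* Two radii [1 / (k + 1)] must fit into [e]: one from [z] to the rational centre, one from the
   centre to a point of the box. *)
pose k := Num.trunc (2 / e).
have k0 : 0 < k.+1%:R^-1 :> R by rewrite invr_gt0.
have ke : k.+1%:R^-1 + k.+1%:R^-1 < e :> R.
  have : 2 / e < k.+1%:R by rewrite truncnS_gt// ?divr_ge0// ltW.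
  rewrite ltr_pdivrMr// => h.
  rewrite -mulr2n -[_ *+ 2]mulr_natl ltr_pdivrMr//; lra.
have apx (x : R) : exists q : rat, `|ratr q - x| < k.+1%:R^-1.
  have [|q] := @rat_in_itvoo R (x - k.+1%:R^-1) (x + k.+1%:R^-1).
    by rewrite ltrBlDr -addrA ltrDl addr_gt0.
  rewrite in_itv/= => qI; exists q; by rewrite distrC ltr_distlC.
have [q1 q1z] := choice (fun i => apx (z.1 ord0 i)).
have [q2 q2z] := apx z.2.
pose q : 'rV[rat]_n * rat * nat := (\row_i q1 i, q2, k).
have bz : box q z by split => //= i; rewrite mxE.
exists q => //; rewrite asboolT// => w [/= w1 w2]; apply: zeU.
split => /=.
  split => // i j; rewrite (ord1 i) /ball/=.
  apply: (le_lt_trans (ler_distD (ratr (q1 j)) _ _)); apply: lt_trans ke.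
  by apply: ltrD; [rewrite distrC; exact: q1z|have := w1 j; rewrite mxE].
apply: (le_lt_trans (ler_distD (ratr q2) _ _)); apply: lt_trans ke.
by apply: ltrD; rewrite // distrC.
Qed.

Lemma continuous_measurable_grushin (f : 'rV[R]_n * R -> R) : continuous f ->
  measurable_fun setT (f : G -> R).
Proof.
move=> /continuousP cf; apply: (measurability _ (RGenOpens.measurableE R)).
move=> _ [_ [a [b ->] <-]]; rewrite setTI.
by apply: open_measurable_grushin; apply: cf; exact: interval_open.
Qed.

End grushin_measurability.

(** * Lebesgue measure under dilations *)

Section lebesgue_scaling.
Context {R : realType}.
Local Open Scope ereal_scope.

Lemma pushforward_measureP d d' (X : measurableType d) (Y : measurableType d')
    (m : {measure set X -> \bar R}) (f : X -> Y) : measurable_fun setT f ->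
  exists nu : {measure set Y -> \bar R},
    (forall A, nu A = m (f @^-1` A)) /\
    forall g : Y -> \bar R, measurable_fun setT g -> (forall y, 0 <= g y) ->
      \int[nu]_y g y = \int[m]_x g (f x).
Proof.
move=> mf.
exists (measure_function_pushforward__canonical__measure_function_Measure m mf).
split => // g mg g0; rewrite -[setT in RHS](preimage_setT f).
by rewrite (ge0_integral_pushforward mf).
Qed.

(** Uniqueness of Lebesgue measure: [c] times the image measure under [x |-> c x + d] gives every
    interval []a, b]] its length. *)
Lemma ge0_integral_affine (c d : R) (f : R -> \bar R) : (0 < c)%R ->
  measurable_fun setT f -> (forall x, 0 <= f x) ->
  \int[lebesgue_measure]_x f x =
  c%:E * \int[lebesgue_measure]_x f (c * x + d)%R.
Proof.
move=> c0 mf f0.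
pose phi (x : measurableTypeR R) : measurableTypeR R := (c * x + d)%R.
have mphi : measurable_fun setT phi.
  by apply: measurable_funD => //; exact: measurable_funM.
have [nu [nuE nuI]] := pushforward_measureP (@lebesgue_measure R) mphi.
pose cnu := mscale (NngNum (ltW c0)) nu.
have cnuE X : cnu X = c%:E * lebesgue_measure (phi @^-1` X).
  by rewrite /cnu /mscale/= nuE.
have nuL A : measurable A -> lebesgue_measure A = cnu A.
  move=> mA; apply: (@lebesgue_measure_unique R cnu _ A mA).
  move=> _ [[a b] _ <-]; rewrite /=.
  transitivity (c%:E * lebesgue_measure (phi @^-1` [set` `]a, b]%R])); last first.
    by rewrite -cnuE.
  have -> : phi @^-1` [set` `]a, b]%R] = [set` `](a - d) / c, (b - d) / c]%R].
    apply/seteqP; split => x; rewrite /= !in_itv/= /phi.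
      by rewrite ltr_pdivrMr// ler_pdivlMr// ltrBlDr lerBrDr mulrC.
    by rewrite ltr_pdivrMr// ler_pdivlMr// ltrBlDr lerBrDr mulrC.
  rewrite !lebesgue_measure_itv/= !lte_fin ltr_pM2r ?invr_gt0// ltrD2r.
  case: ifP => _; last by rewrite mule0.
  rewrite -!EFinB -EFinM; congr EFin; field; exact/lt0r_neq0.
rewrite (eq_measure_integral cnu) => [|A mA _]; last exact: nuL.
by rewrite ge0_integral_mscale//= nuI.
Qed.

(** Induction on the dimension: Tonelli splits off the first coordinate, which contributes one
    factor [c], and the induction hypothesis contributes [c^n]. *)
Lemma ge0_integral_rVZ n (c : R) (f : 'rV[R]_n -> \bar R) : (0 < c)%R ->
  measurable_fun setT f -> (forall x, 0 <= f x) ->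
  \int[@lebesgue_rV R n]_x f x =
  (c ^+ n)%:E * \int[@lebesgue_rV R n]_x f (c *: x)%R.
Proof.
move=> c0; elim: n f => [|n IH] f mf f0.
  rewrite expr0 mul1e; apply: eq_integral => x _; congr f.
  by apply/rowP; case.
have mZ : measurable_fun setT (fun x : 'rV[R]_n => (c *: x)%R).
  apply: measurable_fun_rV => i.
  rewrite (_ : _ \o _ = (fun x => (c * rV_coord i x)%R)).
    by apply: measurable_funM => //; exact: measurable_rV_coord.
  by apply/funext => x; rewrite /rV_coord/= mxE.
have consE (g : 'rV[R]_n.+1 -> \bar R) : measurable_fun setT g ->
    (forall x, 0 <= g x) -> \int[@lebesgue_rV R n.+1]_x g x =
    \int[lebesgue_measure]_x \int[@lebesgue_rV R n]_v g (rV_cons (x, v)).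
  move=> mg g0; have mc := @measurable_rV_cons R n.
  have [nu [nuE nuI]] :=
    pushforward_measureP (@lebesgue_measure R \x @lebesgue_rV R n) mc.
  rewrite (eq_measure_integral nu) => [|A _ _]; last exact/esym/nuE.
  rewrite nuI// fubini_tonelli1//.
  exact: measurableT_comp mg mc.
have mc := @measurable_rV_cons R n.
have mfZ : measurable_fun setT
    (fun z : R * 'rV[R]_n => f (rV_cons (z.1, (c *: z.2)%R))).
  apply: (measurableT_comp mf); apply: (measurableT_comp mc).
  apply: measurable_fun_pair; first exact: measurable_fst.
  exact: measurableT_comp mZ measurable_snd.
have mZS : measurable_fun setT (fun x : 'rV[R]_n.+1 => f (c *: x)%R).
  apply: (measurableT_comp mf); apply: measurable_fun_rV => i.
  rewrite (_ : _ \o _ = (fun x => (c * rV_coord i x)%R)).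
    by apply: measurable_funM => //; exact: measurable_rV_coord.
  by apply/funext => x; rewrite /rV_coord/= mxE.
rewrite !consE//.
under eq_integral => x _.
  rewrite IH//; first over.
  by apply: (measurableT_comp mf); apply: measurableT_comp mc _.
have mF : measurable_fun setT (fun x : measurableTypeR R =>
    \int[@lebesgue_rV R n]_v f (rV_cons (x, (c *: v)%R))).
  exact: (@measurable_fun_fubini_tonelli_F _ _ _ _ R (@lebesgue_rV R n) _ mfZ).
have c0n : (0 <= c ^+ n)%R by rewrite exprn_ge0// ltW.
have I0 x : 0 <= \int[@lebesgue_rV R n]_v f (rV_cons (x, (c *: v)%R)).
  exact: integral_ge0.
rewrite (ge0_integralZl (@lebesgue_measure R) measurableT mF (fun x _ => I0 x));
  last by rewrite lee_fin.
rewrite (ge0_integral_affine 0 c0 mF I0).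
rewrite muleA -EFinM -exprSr; congr (_ * _); apply: eq_integral => x _.
apply: eq_integral => v _; congr f; apply/rowP => i.
rewrite addr0 [RHS]mxE; case: (unliftP ord0 i) => [j|] ->.
  by rewrite !rV_consS/= mxE.
by rewrite !rV_cons0.
Qed.

(** The Jacobian is [c^n] from [x] times [c^2] from [t]; this is where the homogeneous dimension
    [n + 2] enters. *)
Lemma ge0_integral_dilation n (c : R)
    (f : 'rV[R]_n * measurableTypeR R -> \bar R) : (0 < c)%R ->
  measurable_fun setT f -> (forall z, 0 <= f z) ->
  \int[lebesgue_grushin R n]_z f z =
  (c ^+ n.+2)%:E *
  \int[lebesgue_grushin R n]_z f ((c *: z.1)%R, (c ^+ 2 * z.2)%R).
Proof.
move=> c0 mf f0.
have mZ : measurable_fun setT (fun x : 'rV[R]_n => (c *: x)%R).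
  apply: measurable_fun_rV => i.
  rewrite (_ : _ \o _ = (fun x => (c * rV_coord i x)%R)).
    by apply: measurable_funM => //; exact: measurable_rV_coord.
  by apply/funext => x; rewrite /rV_coord/= mxE.
have mg : measurable_fun setT (fun z : 'rV[R]_n * measurableTypeR R =>
    f (z.1, (c ^+ 2 * z.2)%R)).
  apply: (measurableT_comp mf); apply: measurable_fun_pair => //=.
  by apply: measurable_funM => //; exact: measurable_snd.
have mh : measurable_fun setT (fun z : 'rV[R]_n * measurableTypeR R =>
    f ((c *: z.1)%R, (c ^+ 2 * z.2)%R)).
  apply: (measurableT_comp mf); apply: measurable_fun_pair => /=.
    exact: measurableT_comp mZ measurable_fst.
  by apply: measurable_funM => //; exact: measurable_snd.
have c2 : (0 < c ^+ 2)%R by rewrite exprn_gt0.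
have cn : (0 < c ^+ n)%R by rewrite exprn_gt0.
rewrite /lebesgue_grushin !fubini_tonelli1// /fubini_F.
transitivity (\int[@lebesgue_rV R n]_x ((c ^+ 2)%:E *
    \int[lebesgue_measure]_t f (x, (c ^+ 2 * t)%R))).
  apply: eq_integral => x _.
  have mfx : measurable_fun setT (fun t : R => f (x, t)).
    exact: measurableT_comp mf (measurable_pair1 x).
  rewrite (ge0_integral_affine 0 c2 mfx)//.
  by congr (_ * _); apply: eq_integral => t _; rewrite addr0.
have mF : measurable_fun setT (fun x : 'rV[R]_n =>
    \int[lebesgue_measure]_t f (x, (c ^+ 2 * t)%R)).
  exact: (@measurable_fun_fubini_tonelli_F _ _ _ _ R (@lebesgue_measure R) _ mg).
have F0 x : 0 <= \int[lebesgue_measure]_t f (x, (c ^+ 2 * t)%R).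
  exact: integral_ge0.
rewrite (ge0_integralZl (@lebesgue_rV R n) measurableT mF (fun x _ => F0 x));
  last by rewrite lee_fin ltW.
by rewrite (ge0_integral_rVZ c0 mF F0) muleA -EFinM -exprD.
Qed.

End lebesgue_scaling.

(** * Integration along rays *)

Section lebesgue_grushin_sigma_finite.
Context {R : realType} {n : nat}.

(* On products, instance resolution finds only the library's finite measures:
   the subprobability instance comes first and hides the sigma-finite one. *)
Let sigma_finite_lebesgue_grushin : sigma_finite setT (lebesgue_grushin R n).
Proof.
have /sigma_finiteP[F [TF ndF Foo]] := sigma_finiteT (@lebesgue_rV R n).
have /sigma_finiteP[K [TK ndK Koo]] := sigma_finiteT (@lebesgue_measure R).
exists (fun k => F k `*` K k).
  rewrite -setXTT TF TK predeqE => -[x y]; split.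
    move=> [/= [a _ Fax] [b _ Kby]]; exists (maxn a b) => //; split.
    - by move: x Fax; exact/subsetPset/ndF/leq_maxl.
    - by move: y Kby; exact/subsetPset/ndK/leq_maxr.
  by move=> [a _ []/= ? ?]; split; exists a.
move=> k; have [? ?] := Foo k; have [? ?] := Koo k.
split; first exact: measurableX.
rewrite /lebesgue_grushin product_measure1E// lte_mul_pinfty//.
by rewrite ge0_fin_numE.
Qed.

HB.instance Definition _ := Measure_isSigmaFinite.Build _ _ _
  (lebesgue_grushin R n) sigma_finite_lebesgue_grushin.

End lebesgue_grushin_sigma_finite.

(** * Dilations, homogeneity of the gauge, and averaging over dilations *)

Section dilations.
Context {R : realType} {n : nat}.
Local Notation G := ('rV[R]_n * measurableTypeR R)%type.
Implicit Types (z w : 'rV[R]_n * R) (c : R).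

Definition dil c z : 'rV[R]_n * R := (c *: z.1, c ^+ 2 * z.2).

Lemma dilM a b z : dil a (dil b z) = dil (a * b) z.
Proof. by rewrite /dil/= scalerA mulrA exprMn. Qed.

Lemma dil1 z : dil 1 z = z.
Proof. by case: z => x t; rewrite /dil/= scale1r expr1n mul1r. Qed.

Lemma enorm_ge0 (x : 'rV[R]_n) : 0 <= enorm x.
Proof. exact: sqrtr_ge0. Qed.

Lemma sqr_enorm (x : 'rV[R]_n) : enorm x ^+ 2 = \sum_i x ord0 i ^+ 2.
Proof. by rewrite sqr_sqrtr// sumr_ge0// => i _; exact: sqr_ge0. Qed.

Lemma rho_ge0 z : 0 <= rho z.
Proof. exact: powR_ge0. Qed.

Lemma rhoX4 z : rho z ^+ 4 = enorm z.1 ^+ 4 + 4 * z.2 ^+ 2.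
Proof.
have h : 0 <= enorm z.1 ^+ 4 + 4 * z.2 ^+ 2.
  by apply: addr_ge0; [exact/exprn_ge0/enorm_ge0|exact/mulr_ge0/sqr_ge0].
rewrite /rho -powR_mulrn ?powR_ge0// -powRrM mulVf ?powRr1//.
Qed.

Lemma rho0 : rho ((0, 0) : 'rV[R]_n * R) = 0.
Proof.
apply/eqP; rewrite -[_ == 0](expf_eq0 _ 4) rhoX4/= expr0n/= mulr0 addr0.
rewrite -[4%N]/(2 * 2)%N exprM sqr_enorm big1 ?expr0n// => i _.
by rewrite mxE expr0n.
Qed.

Lemma rho_eq0 z : (rho z == 0) = (z == (0, 0)).
Proof.
apply/idP/eqP => [|->]; last by rewrite rho0.
rewrite -[_ == 0](expf_eq0 _ 4) rhoX4 paddr_eq0; [|exact/exprn_ge0/enorm_ge0|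
  exact/mulr_ge0/sqr_ge0].
rewrite expf_eq0/= mulf_eq0 expf_eq0/= pnatr_eq0/= => /andP[x0 /eqP t0].
case: z x0 t0 => x t /= x0 ->; congr pair; apply/rowP => i; rewrite mxE.
move: x0; rewrite -[_ == 0](expf_eq0 _ 2) sqr_enorm psumr_eq0; last first.
  by move=> j _; exact: sqr_ge0.
by move=> /allP/(_ i); rewrite mem_index_enum expf_eq0/= => /(_ isT) /eqP.
Qed.

Lemma enormZ c (x : 'rV[R]_n) : 0 <= c -> enorm (c *: x) = c * enorm x.
Proof.
move=> c0; rewrite -[c in RHS](ger0_norm c0) -sqrtr_sqr -sqrtrM ?sqr_ge0//.
by congr Num.sqrt; rewrite mulr_sumr; apply: eq_bigr => i _; rewrite mxE exprMn.
Qed.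

Lemma rho_dil c z : 0 <= c -> rho (dil c z) = c * rho z.
Proof.
move=> c0; apply/eqP; rewrite -(@eqrXn2 _ 4)// ?mulr_ge0 ?rho_ge0//.
rewrite exprMn !rhoX4/= enormZ//; apply/eqP; ring.
Qed.

Lemma measurable_enorm : measurable_fun setT (fun z : G => enorm z.1).
Proof.
have ms : measurable_fun setT (fun z : G => \sum_i z.1 ord0 i ^+ 2).
  by apply: measurable_sum => i; apply: measurable_funX; exact: measurable_coord1.
have h := @continuous_measurable_fun R _ (@sqrt_continuous R).
exact: (measurableT_comp h ms).
Qed.

Lemma measurable_rho : measurable_fun setT (rho : G -> R).
Proof.
apply: (measurableT_comp (@measurable_powR R _)).
apply: measurable_funD; first by apply: measurable_funX; exact: measurable_enorm.
by apply: measurable_funM => //; apply: measurable_funX; exact: measurable_snd.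
Qed.

Lemma measurable_dil : measurable_fun setT
  (fun q : R * G => (dil q.1 q.2 : G)).
Proof.
apply: measurable_fun_pair => /=; last first.
  apply: measurable_funM; first by apply: measurable_funX; exact: measurable_fst.
  exact: measurableT_comp measurable_snd measurable_snd.
apply: measurable_fun_rV => i.
rewrite [X in measurable_fun _ X](_ : _ =
    (fun q : R * G => q.1 * rV_coord i q.2.1)); last first.
  by apply/funext => q; rewrite /rV_coord/= mxE.
apply: measurable_funM; first exact: measurable_fst.
exact: measurableT_comp (measurable_coord1 i) measurable_snd.
Qed.

Let annulus : set G := [set z | 1 <= rho z < expR 1].

Let measurable_annulus : measurable annulus.
Proof.
rewrite (_ : annulus = rho @^-1` `[1, expR 1[).
  by rewrite -[X in measurable X]setTI; exact: measurable_rho.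
by apply/seteqP; split => z; rewrite /annulus /= in_itv.
Qed.

(* For every [z != o] the dilates [dil (expR s) z] lie in the annulus for a set
   of [s] of measure [1]; averaging over [s] replaces polar coordinates. *)
Let integral_annulus (f : G -> \bar R) z : f (0, 0) = 0%E -> (0 <= f z)%E ->
  (\int[lebesgue_measure]_s ((\1_annulus (dil (expR s) z))%:E * f z) = f z)%E.
Proof.
move=> f00 fz0; have [->|z0] := eqVneq z (0, 0).
  by rewrite f00; under eq_integral do rewrite mule0; rewrite integral0.
have rz : 0 < rho z by rewrite lt_neqAle eq_sym rho_eq0 z0 rho_ge0.
pose I := [set` `[- ln (rho z), 1 - ln (rho z)[].
have rE s : rho (dil (expR s) z) = expR (s + ln (rho z)).
  by rewrite rho_dil ?expR_ge0// expRD lnK.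
have IE s : annulus (dil (expR s) z) = I s.
  rewrite /annulus/I/= in_itv/= rE -{1}expR0 ler_expR ltr_expR.
  by congr is_true; apply/idP/idP => /andP[? ?]; apply/andP; split; lra.
have {}IE s : \1_annulus (dil (expR s) z) = \1_I s :> R.
  by rewrite !indicE; congr ((nat_of_bool _)%:R); apply/idP/idP; rewrite !in_setE IE.
under eq_integral => s _ do rewrite IE.
have mI : measurable I by exact: measurable_itv.
rewrite ge0_integralZr//; last by apply/measurable_EFinP; exact: measurable_indic.
have I1 : lebesgue_measure I = 1%E.
  rewrite lebesgue_measure_itv/= lte_fin ifT; last by lra.
  by rewrite -EFinB opprK; congr EFin; ring.
by rewrite integral_indic// setIT [X in (X * _)%E]I1 mul1e.
Qed.

Let measurable_rays (f : G -> \bar R) : measurable_fun setT f ->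
  measurable_fun setT
    (fun q : R * G => (expR (- q.1) ^+ n.+2)%:E * f (dil (expR (- q.1)) q.2))%E.
Proof.
move=> mf; have mexpN : measurable_fun setT (fun q : R * G => expR (- q.1)).
  by apply: measurableT_comp => //; exact: measurableT_comp.
apply: emeasurable_funM; first by apply/measurable_EFinP; exact: measurable_funX.
have mp : measurable_fun setT (fun q : R * G => (expR (- q.1), q.2)).
  exact: measurable_fun_pair.
exact: measurableT_comp mf (measurableT_comp measurable_dil mp).
Qed.

Let ray_ge0 (f : G -> \bar R) w s : (forall z, 0 <= f z)%E ->
  (0 <= (expR (- s) ^+ n.+2)%:E * f (dil (expR (- s)) w))%E.
Proof. by move=> f0; rewrite mule_ge0// lee_fin exprn_ge0// expR_ge0. Qed.

(** Write [f z] as its average over dilations and exchange the integrals. For fixed [s] the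
    substitution [z = dil (e^-s) w] moves the annulus condition to [w] and produces the Jacobian;
    then exchange back. The origin is fixed by all dilations and never meets the annulus, whence
    [f (0, 0) = 0]. *)
Let polar_integral (f : G -> \bar R) : measurable_fun setT f ->
  (forall z, 0 <= f z)%E -> f (0, 0) = 0%E ->
  (\int[lebesgue_grushin R n]_z f z =
   \int[lebesgue_grushin R n]_w ((\1_annulus w)%:E *
     \int[lebesgue_measure]_s ((expR (- s) ^+ n.+2)%:E * f (dil (expR (- s)) w))))%E.
Proof.
move=> mf f0 f00.
have mA : measurable_fun setT (\1_annulus : G -> R) by exact: measurable_indic.
have m1 : measurable_fun setT (fun q : R * G => (\1_annulus q.2 : R)%:E).
  by apply/measurable_EFinP; exact: measurableT_comp mA measurable_snd.
have m3 := measurable_rays mf.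
have m4 : measurable_fun setT (fun q : R * G => (\1_annulus q.2 : R)%:E *
    ((expR (- q.1) ^+ n.+2)%:E * f (dil (expR (- q.1)) q.2)))%E.
  exact: emeasurable_funM.
have m5 : measurable_fun setT (fun q : R * G =>
    (\1_annulus (dil (expR q.1) q.2 : G) : R)%:E * f q.2)%E.
  apply: emeasurable_funM; last exact: measurableT_comp mf measurable_snd.
  have mp : measurable_fun setT (fun q : R * G => (expR q.1, q.2)).
    by apply: measurable_fun_pair => //; exact: measurableT_comp.
  by apply/measurable_EFinP; exact: measurableT_comp mA (measurableT_comp measurable_dil mp).
transitivity (\int[lebesgue_grushin R n]_z \int[lebesgue_measure]_s
    ((\1_annulus (dil (expR s) z : G) : R)%:E * f z))%E.
  by apply: eq_integral => z _; rewrite integral_annulus.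
rewrite -(@fubini_tonelli _ _ _ _ R (@lebesgue_measure R) (lebesgue_grushin R n) _ m5) => [|q];
  last by rewrite mule_ge0// lee_fin.
transitivity (\int[lebesgue_measure]_s \int[lebesgue_grushin R n]_w ((\1_annulus w : R)%:E *
    ((expR (- s) ^+ n.+2)%:E * f (dil (expR (- s)) w))))%E.
  apply: eq_integral => s _.
  have ms : measurable_fun setT (fun z : G =>
      ((\1_annulus (dil (expR s) z) : R)%:E * f z)%E).
    exact: measurableT_comp m5 (measurable_pair1 s).
  have ms0 z : (0 <= (\1_annulus (dil (expR s) z) : R)%:E * f z)%E.
    by rewrite mule_ge0// lee_fin.
  rewrite (ge0_integral_dilation (expR_gt0 (- s)) ms ms0).
  have md : measurable_fun setT (fun z : G =>
      ((\1_annulus (dil (expR s) (dil (expR (- s)) z)) : R)%:E *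
       f (dil (expR (- s)) z))%E).
    exact: measurableT_comp ms (measurableT_comp measurable_dil (measurable_pair1 _)).
  rewrite -(ge0_integralZl (lebesgue_grushin R n) measurableT md)//.
  by apply: eq_integral => z _; rewrite dilM -expRD subrr expR0 dil1 muleCA.
have p4 q : (0 <= (\1_annulus q.2 : R)%:E *
    ((expR (- q.1) ^+ n.+2)%:E * f (dil (expR (- q.1)) q.2)))%E.
  by rewrite mule_ge0 ?lee_fin// ray_ge0.
transitivity (\int[lebesgue_grushin R n]_w \int[lebesgue_measure]_s
    ((\1_annulus w : R)%:E * ((expR (- s) ^+ n.+2)%:E * f (dil (expR (- s)) w))))%E.
  exact: (@fubini_tonelli _ _ _ _ R (@lebesgue_measure R) (lebesgue_grushin R n) _ m4 p4).
apply: eq_integral => w _; rewrite ge0_integralZl//.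
- exact: measurableT_comp m3 (measurable_pair2 w).
- by move=> s _; exact: ray_ge0.
Qed.

(** The averaged formula involves every [w] in the annulus. Translating [s] by [ln (rho w)] replaces
    [w] by its normalisation and multiplies the ray integrals of [f] and [g] by the same factor
    [rho(w)^-(n+2)], so rays with [rho w = 1] suffice. *)
Lemma le_integral_rays (f g : G -> \bar R) :
  measurable_fun setT f -> measurable_fun setT g ->
  (forall z, 0 <= f z)%E -> (forall z, 0 <= g z)%E ->
  f (0, 0) = 0%E -> g (0, 0) = 0%E ->
  (forall w, rho w = 1%R ->
    \int[lebesgue_measure]_s ((expR (- s) ^+ n.+2)%:E * f (dil (expR (- s)) w)) <=
    \int[lebesgue_measure]_s ((expR (- s) ^+ n.+2)%:E * g (dil (expR (- s)) w)))%E ->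
  (\int[lebesgue_grushin R n]_z f z <= \int[lebesgue_grushin R n]_z g z)%E.
Proof.
move=> mf mg f0 g0 f00 g00 fg.
rewrite (polar_integral mf f0 f00) (polar_integral mg g0 g00).
have mray h (w : G) : measurable_fun setT h ->
    measurable_fun setT (fun s : R => (expR (- s) ^+ n.+2)%:E * h (dil (expR (- s)) w))%E.
  by move=> mh; exact: measurableT_comp (measurable_rays mh) (measurable_pair2 w).
have mJ h : measurable_fun setT h -> (forall z, 0 <= h z)%E ->
    measurable_fun setT (fun w : G => (\1_annulus w : R)%:E *
      \int[lebesgue_measure]_s ((expR (- s) ^+ n.+2)%:E * h (dil (expR (- s)) w)))%E.
  move=> mh h0; apply: emeasurable_funM.
    by apply/measurable_EFinP; exact: measurable_indic.
  apply: (@measurable_fun_fubini_tonelli_G _ _ _ _ R (@lebesgue_measure R) _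
    (measurable_rays mh)).
  by move=> q; exact: ray_ge0.
have shift h w : measurable_fun setT h -> (forall z, 0 <= h z)%E -> 0 < rho w ->
    (\int[lebesgue_measure]_s ((expR (- s) ^+ n.+2)%:E * h (dil (expR (- s)) w)) =
     (expR (- ln (rho w)) ^+ n.+2)%:E * \int[lebesgue_measure]_s
       ((expR (- s) ^+ n.+2)%:E *
        h (dil (expR (- s)) (dil (expR (- ln (rho w))) w))))%E.
  move=> mh h0 w0.
  rewrite (ge0_integral_affine (ln (rho w)) ltr01 (mray _ w mh) (fun s => ray_ge0 _ s h0)).
  rewrite mul1e -(ge0_integralZl (@lebesgue_measure R) measurableT (mray _ _ mh)).
  - apply: eq_integral => s _; rewrite mul1r opprD expRD dilM exprMn EFinM.
    by rewrite muleCA muleA.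
  - by move=> s _; exact: ray_ge0.
  - by rewrite lee_fin exprn_ge0// expR_ge0.
apply: ge0_le_integral; rewrite //; [|exact: mJ|exact: mJ|].
  by move=> w _; rewrite mule_ge0 ?lee_fin// integral_ge0// => s _; exact: ray_ge0.
move=> w _; rewrite indicE; have [wA|_] := boolP (w \in annulus); last by rewrite !mul0e.
move: wA; rewrite inE => /andP[w1 _]; have w0 : 0 < rho w by exact: lt_le_trans w1.
rewrite !mul1e (shift f)// (shift g)// lee_pmul2l ?lte_fin ?exprn_gt0 ?expR_gt0//.
by apply: fg; rewrite rho_dil ?expR_ge0// expRN lnK// mulVf// gt_eqF.
Qed.

End dilations.

(** * The one-dimensional inequality *)

Section power_calculus.
Context {R : realType}.
Implicit Types (p s x : R) (f g W V : R -> R).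

(** The exponent [0] is included because it occurs as [p - 2] when [p = 2]; the convention that [0]
    to the power [0] is [1] makes the function constant. *)
Lemma continuous_norm_powR p : 0 <= p -> continuous (fun x : R => `|x| `^ p).
Proof.
rewrite le_eqVlt => /predU1P[<-|p0] x.
  rewrite (_ : (fun _ => _) = cst 1); first exact: cvg_cst.
  by apply/funext => y; rewrite powRr0.
have [->|x0] := eqVneq x 0.
  rewrite /prop_for /continuous_at normr0 powR0 ?gt_eqF//.
  apply/cvgr0Pnorm_lt => e e0; near=> y.
  rewrite ger0_norm ?powR_ge0// -[ltRHS](powRr1 (ltW e0)) -(mulVf (lt0r_neq0 p0)).
  rewrite powRrM gt0_ltr_powR ?nnegrE ?powR_ge0//; near: y.
  apply: (cvgr0_norm_lt (fun y : R => y)); first exact: cvg_id.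
  exact: powR_gt0.
have nx : 0 < `|x| by rewrite normr_gt0.
apply: (@continuous_comp _ _ _ (@Num.norm _ R) (@powR R ^~ p)).
  exact: norm_continuous.
apply: differentiable_continuous; apply/derivable1_diffP.
by have [] := is_derive1_powR p nx.
Unshelve. all: by end_near. Qed.

Lemma is_derive_norm_powR p x : 2 <= p ->
  is_derive x 1 (fun y : R => `|y| `^ p) (p * (x * `|x| `^ (p - 2))).
Proof.
move=> p2; have E y : 0 <= y -> y * y `^ (p - 2) = y `^ (p - 1).
  move=> y0; rewrite -(@mulr_powRB1 _ y (p - 1))//; last by lra.
  by congr (_ * _ `^ _); lra.
have [x0|x0|->] := ltgtP x 0.
- have Nx0 : 0 < - x by rewrite oppr_gt0.
  have d := @is_derive1_comp _ (fun x : R => x `^ p) -%R x _ _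
    (is_derive1_powR p Nx0) (is_deriveN (is_derive_id x (1 : R))).
  have nE : \forall y \near x, (fun x : R => x `^ p) (- y) = `|y| `^ p.
    near=> y; rewrite ltr0_norm//.
    by near: y; exact: lt_nbhsl.
  apply: is_derive_eq (near_eq_is_derive nE d) _.
  by rewrite mulrN1 ltr0_norm// -E ?ltW//; ring.
- have nE : \forall y \near x, y `^ p = `|y| `^ p.
    near=> y; rewrite gtr0_norm//.
    by near: y; exact: lt_nbhsr.
  apply: is_derive_eq (near_eq_is_derive nE (is_derive1_powR p x0)) _.
  by rewrite gtr0_norm// E ?ltW.
- rewrite mul0r mulr0.
  (* The difference quotient at [0] has absolute value [|h|^(p-1)], at most [|h|] for [|h| < 1]
     since [p - 1 >= 1]. *)
  have c0 : h^-1 * `|h| `^ p @[h --> (0 : R)^'] --> (0 : R).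
    apply/cvgr0Pnorm_lt => e e0; near=> h.
    have h0 : h != 0 by near: h; exact: nbhs_dnbhs_neq.
    have nh : 0 < `|h| by rewrite normr_gt0.
    have h1 : `|h| < Num.min 1 e.
      near: h; apply: dnbhs0_lt.
      by rewrite lt_min ltr01.
    move: h1; rewrite lt_min => /andP[h1 he].
    rewrite normrM normfV (ger0_norm (powR_ge0 _ _)).
    rewrite -(@mulr_powRB1 _ `|h| p)//; last by lra.
    rewrite mulKf ?gt_eqF//; apply: le_lt_trans he.
    by apply: ge1r_powR; [rewrite nh ltW|lra].
  suff qE : (fun h : R => h^-1 * `|h| `^ p) =
      (fun h : R => h^-1 *: ((fun y : R => `|y| `^ p) (h *: (1 : R) + 0) -
        (fun y : R => `|y| `^ p) 0)).
    by move: c0; rewrite qE => c0; split; [exact: cvgP c0|exact: cvg_lim c0].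
  apply/funext => h; rewrite addr0 [h *: 1]mulr1 normr0 powR0 ?subr0//.
  by apply/eqP; lra.
Unshelve. all: by end_near. Qed.

Lemma is_derive_ln_scaled r s : 0 < r -> 0 < s ->
  is_derive s 1 (fun x : R => ln (r * x)) s^-1.
Proof.
move=> r0 s0; have d1 : is_derive s 1 (fun x : R => r * x) r.
  by apply: is_derive_eq (is_deriveZ r (is_derive_id s (1 : R))) _; rewrite [_ *: _]mulr1.
apply: is_derive_eq (is_derive1_comp (is_derive1_ln (mulr_gt0 r0 s0)) d1) _.
by field; rewrite !gt_eqF.
Qed.

(** The factor [f |f|^(p-2)] is pulled out to match the expansion: for [W' = 1], multiplying by
    [k^(p-1)] gives its linear term [p a |a|^(p-2) b] with [a = k f / W] and [b = f' - a]. Applied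
    to [W = s] and to [W = |ln (r s)|]. *)
Lemma is_derive_weighted_norm_powR p W f (W' f' : R) s : 2 <= p -> 0 < W s ->
  is_derive s 1 W W' -> is_derive s 1 f f' ->
  is_derive s 1 (fun x => W x `^ (1 - p) * `|f x| `^ p)
    (p * (W s `^ (1 - p) * (f s * `|f s| `^ (p - 2)) *
      (f' - (p - 1) / p * f s * W' / W s))).
Proof.
move=> p2 W0 dW df.
have d1 := is_derive1_comp (is_derive1_powR (1 - p) W0) dW.
have d2 := is_derive1_comp (is_derive_norm_powR (f s) p2) df.
apply: is_derive_eq (is_deriveM d1 d2) _.
transitivity (W s `^ (1 - p) * (p * (f s * `|f s| `^ (p - 2)) * f') +
    `|f s| `^ p * ((1 - p) * W s `^ (1 - p - 1) * W')) => //.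
have -> : `|f s| `^ p = f s * f s * `|f s| `^ (p - 2).
  have [->|f0] := eqVneq (f s) 0.
    by rewrite normr0 powR0 ?mul0r//; apply/eqP; lra.
  rewrite -expr2 -real_normK ?num_real// -powR_mulrn// -powRD.
    by congr powR; lra.
  by rewrite normr_eq0 f0 implybT.
have -> : W s `^ (1 - p - 1) = W s `^ (1 - p) / W s.
  by rewrite -powR_inv1 ?ltW// -powRD// (gt_eqF W0) implybT.
by field; rewrite !gt_eqF//; lra.
Qed.

End power_calculus.

(** * Both expansions combined, pointwise in [s] *)

Section hardy_pointwise.
Context {R : realType}.
Implicit Types (p s w x c G D V sg : R).

Let S p x : R := x * `|x| `^ (p - 2).

Let S_scale p c x : 2 <= p -> 0 <= c -> S p (c * x) = c `^ (p - 1) * S p x.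
Proof.
move=> p2 c0; rewrite /S normrM (ger0_norm c0) powRM// -(@mulr_powRB1 _ c (p - 1))//; last by lra.
rewrite (_ : p - 1 - 1 = p - 2); last by ring.
ring.
Qed.

Let S_sign p sg x : (sg == 1) || (sg == -1) -> S p (sg * x) = sg * S p x.
Proof.
move=> /orP[] /eqP ->; rewrite /S ?mul1r// !mulN1r normrN.
by rewrite mulNr.
Qed.

(* For [G = g s], [D = g' s], [w = sg * ln (r * s)] and
   [V = s^-k * g s - const], the last two summands are derivatives in the form
   given by [is_derive_weighted_norm_powR] (its [W'] is the factor [1], resp.
   [sg / s]). The inequality itself needs no relation between [G] and [V]. *)
Lemma hardy_pointwise p s w sg G D V (k := (p - 1) / p) : 2 <= p -> 0 < s ->
  0 < w -> (sg == 1) || (sg == -1) ->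
  k `^ p * (`|G| `^ p / s `^ p) +
  cp p * k `^ p * (`|s `^ k * V| `^ p / (s `^ p * w `^ p)) +
  k `^ (p - 1) * (p * (s `^ (1 - p) * (G * `|G| `^ (p - 2)) *
    (D - k * G * 1 / s))) +
  cp p * k `^ (p - 1) * (sg * (p * (w `^ (1 - p) * (V * `|V| `^ (p - 2)) *
    (s `^ (- k) * (D - k * G / s) - k * V * (sg / s) / w)))) <= `|D| `^ p.
Proof.
move=> p2 s0 w0 sg1; have [s0' w0'] : 0 <= s /\ 0 <= w by rewrite !ltW.
have k0 : 0 <= k by apply: divr_ge0; lra.
have sgE : `|sg| = 1.
  by move: sg1 => /orP[] /eqP ->; rewrite ?normr1// normrN1.
pose a := k / s * G; pose b := D - a.
have := powR_norm_expansion a b p2; rewrite (_ : a + b = D); last by rewrite /b; ring.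
(* In the variable [y = sg * w] the Hardy substitution for [V] subtracts [k V / y] from [dV/dy].
   Since [b = s^k v'] and [dy = ds / s], in terms of [b] the subtracted quantity acquires the factor
   [s^k / s]. *)
pose a2 := k * s `^ k / (s * w) * (sg * V).
have := powR_norm_expansion a2 (b - a2) p2.
rewrite (_ : a2 + (b - a2) = b); last by ring.
rewrite -![_ * `|_| `^ (p - 2)]/(S p _).
have ks0 : 0 <= k / s by exact: divr_ge0.
have c0 : 0 <= k * s `^ k / (s * w).
  by apply: divr_ge0; apply: mulr_ge0 => //; exact: powR_ge0.
have aE : `|a| `^ p = k `^ p * (`|G| `^ p / s `^ p).
  rewrite /a normrM (ger0_norm ks0) powRM// powRM ?invr_ge0// powR_invr//.
  ring.
have a2E : `|a2| `^ p = k `^ p * (`|s `^ k * V| `^ p / (s `^ p * w `^ p)).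
  rewrite /a2 normrM (ger0_norm c0) (normrM sg) sgE mul1r (normrM (s `^ k)).
  rewrite (ger0_norm (powR_ge0 _ _)).
  have sw0 : 0 <= s * w by exact: mulr_ge0.
  have ks0' : 0 <= k * s `^ k by apply: mulr_ge0 => //; exact: powR_ge0.
  rewrite powRM// powRM ?invr_ge0// powR_invr// (powRM _ k0) ?powR_ge0//.
  rewrite (powRM _ s0' w0') (powRM _ (powR_ge0 _ _) (normr_ge0 _)).
  ring.
have sV q : s `^ (- q) = (s `^ q)^-1 by rewrite powRN.
have SaE : S p a = k `^ (p - 1) * (s `^ (1 - p) * S p G).
  rewrite /a S_scale// powRM ?invr_ge0// powR_invr// -sV opprB; ring.
have Sa2E : S p a2 = k `^ (p - 1) * (s `^ k * s `^ (- k)) * (s `^ (- k) * w `^ (1 - p) * (sg * S p V)).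
  have sw0 : 0 <= s * w by exact: mulr_ge0.
  have ks0' : 0 <= k * s `^ k by apply: mulr_ge0 => //; exact: powR_ge0.
  rewrite /a2 S_scale// S_sign// powRM ?invr_ge0// powR_invr//.
  rewrite (powRM _ k0) ?powR_ge0// (powRM _ s0' w0') -powRrM.
  (* [k (p - 1) = p - 1 - k] because [k = (p - 1) / p]; it is this exponent that makes
     [s^(p-1) |v'|^p ds] equal to [|dv/dy|^p dy]. *)
  have -> : s `^ (k * (p - 1)) = s `^ (- k) * s `^ (p - 1).
    rewrite -powRD; last by rewrite (gt_eqF s0) implybT.
    by congr powR; rewrite /k; field; apply/eqP; lra.
  rewrite (_ : 1 - p = - (p - 1)); last by ring.
  rewrite [w `^ (- _)]powRN [s `^ (- k)]powRN.
  by field; rewrite !gt_eqF// powR_gt0.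
have sk1 : s `^ k * s `^ (- k) = 1.
  by rewrite -powRD ?subrr ?powRr0// (gt_eqF s0) implybT.
have ba2 : s `^ (- k) * (b - a2) = s `^ (- k) * (D - k * G / s) - k * V * (sg / s) / w.
  rewrite mulrBr; congr (_ - _); first by rewrite /b /a; ring.
  rewrite /a2 [LHS](_ : _ = (s `^ k * s `^ (- k)) * (k * V * (sg / s) / w)).
    by rewrite sk1 mul1r.
  by field; rewrite !gt_eqF.
rewrite -ba2 aE a2E SaE Sa2E sk1 mulr1 => h2 h1.
have cp0 := cp_gt0 p2.
(* The remainder [cp |b - a2|^p] of the second expansion is dropped here. *)
have h3 : cp p * (k `^ p * (`|s `^ k * V| `^ p / (s `^ p * w `^ p)) +
    p * (k `^ (p - 1) * (s `^ (- k) * w `^ (1 - p) * (sg * S p V))) * (b - a2)) <=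
    cp p * `|b| `^ p.
  rewrite ler_pM2l//; apply: le_trans h2; rewrite lerDl mulr_ge0 ?powR_ge0//.
  exact: ltW.
have {}h1 := le_trans (lerD (lexx _) h3) h1.
apply: le_trans h1; rewrite -subr_ge0 le_eqVlt; apply/orP; left; apply/eqP.
by rewrite /b /a; field; rewrite !gt_eqF// powR_gt0.
Qed.

End hardy_pointwise.

(** * Integration over the half-line of one ray *)

Section hardy_segment.
Context {R : realType}.
Variables (p r : R) (g g' : R -> R).
Hypotheses (p2 : 2 <= p) (r0 : 0 < r).
Hypothesis dg : forall s : R, is_derive s (1 : R) g (g' s).
Hypothesis cg' : continuous g'.
Let k := (p - 1) / p.
(** [v] minus its value at [s = 1 / r], so that [s^k V s] is the difference inside [dC]. Below, [A]
    is the gradient integrand along a ray and [B] the Hardy and remainder integrands with their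
    constants, all without the angular weight; [P] and [T] are the boundary terms of the two exact
    derivatives. *)
Let V s := s `^ (- k) * g s - r `^ k * g r^-1.
Let S x : R := x * `|x| `^ (p - 2).
Let A s : R := `|g' s| `^ p.
Let B s : R := k `^ p * (`|g s| `^ p / s `^ p) + cp p * k `^ p *
  (`|g s - s `^ k * r `^ k * g r^-1| `^ p / (s `^ p * `|ln (r * s)| `^ p)).
Let P s : R := s `^ (1 - p) * `|g s| `^ p.
Let T s : R := `|ln (r * s)| `^ (1 - p) * `|V s| `^ p.

Let V' s := s `^ (- k) * (g' s - k * g s / s).

Let is_derive_V (s : R) : 0 < s -> is_derive s 1 V (V' s).
Proof.
move=> s0; have d := is_deriveB (is_deriveM (is_derive1_powR (- k) s0) (dg s))
  (is_derive_cst (r `^ k * g r^-1) s 1).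
apply: is_derive_eq d _; rewrite subr0.
transitivity (s `^ (- k) * g' s + g s * (- k * s `^ (- k - 1))) => //.
rewrite powRD; last by rewrite (gt_eqF s0) implybT.
by rewrite (powR_inv1 (ltW s0)) /V'; ring.
Qed.

(** With [sg = -1] for [s < 1 / r] and [sg = 1] for [s > 1 / r] this is [|ln (r s)|], written as a
    smooth function on each side. *)
Let W (sg s : R) := sg * ln (r * s).

Let is_derive_W (sg s : R) : 0 < s -> is_derive s 1 (W sg) (sg / s).
Proof.
move=> s0; exact: is_deriveZ (is_derive_ln_scaled r0 s0).
Qed.

(** A primitive of the two exact derivatives in [hardy_pointwise]. *)
Let Phi sg s := k `^ (p - 1) * P s +
  cp p * k `^ (p - 1) * (sg * (W sg s `^ (1 - p) * `|V s| `^ p)).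

Let dPhi sg s :=
  k `^ (p - 1) * (p * (s `^ (1 - p) * S (g s) * (g' s - k * g s * 1 / s))) +
  cp p * k `^ (p - 1) * (sg * (p * (W sg s `^ (1 - p) * S (V s) *
    (V' s - k * V s * (sg / s) / W sg s)))).

Let is_derive_Phi (sg s : R) : 0 < s -> 0 < W sg s ->
  is_derive s (1 : R) (Phi sg) (dPhi sg s).
Proof.
move=> s0 W0.
have d1 := is_derive_weighted_norm_powR p2 s0 (is_derive_id s (1 : R)) (dg s).
have d2 := is_derive_weighted_norm_powR p2 W0 (is_derive_W sg s0) (is_derive_V s0).
exact: is_deriveD (is_deriveZ _ d1) (is_deriveZ _ (is_deriveZ _ d2)).
Qed.

Let le_A sg s : (sg == 1) || (sg == -1) -> 0 < s -> 0 < W sg s ->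
  B s + dPhi sg s <= A s.
Proof.
move=> sg1 s0 W0.
rewrite /B; have := hardy_pointwise (g s) (g' s) (V s) p2 s0 W0 sg1.
suff -> : s `^ k * V s = g s - s `^ k * r `^ k * g r^-1.
  have -> : `|ln (r * s)| = W sg s.
    move: W0 sg1; rewrite /W => W0 /orP[] /eqP sgE.
      by rewrite ger0_norm ?sgE ?mul1r//; move: W0; rewrite sgE mul1r => /ltW.
    rewrite ler0_norm ?sgE ?mulN1r//.
    by move: W0; rewrite sgE mulN1r oppr_gt0 => /ltW.
  by rewrite /dPhi !addrA.
rewrite /V mulrBr mulrA -powRD; last by rewrite (gt_eqF s0) implybT.
by rewrite subrr powRr0 mul1r mulrA.
Qed.

Let derivable_continuous (f : R -> R) (s df : R) :
  is_derive s (1 : R) f df -> {for s, continuous f}.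
Proof. by case=> /derivable1_diffP/differentiable_continuous. Qed.

Let continuous_powR q (s : R) : 0 < s -> {for s, continuous (fun x : R => x `^ q)}.
Proof. by move=> s0; exact: derivable_continuous (is_derive1_powR q s0). Qed.

Let continuous_norm_comp q (f : R -> R) s : 0 <= q -> {for s, continuous f} ->
  {for s, continuous (fun x => `|f x| `^ q)}.
Proof.
by move=> q0 cf; exact: (continuous_comp cf (@continuous_norm_powR R q q0 (f s))).
Qed.

Let continuous_S (f : R -> R) s : {for s, continuous f} ->
  {for s, continuous (fun x => S (f x))}.
Proof.
have q0 : 0 <= p - 2 by rewrite subr_ge0.
by move=> cf; exact: (continuousM cf (continuous_norm_comp q0 cf)).
Qed.

Let continuous_divr (f h : R -> R) s : h s != 0 -> {for s, continuous f} ->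
  {for s, continuous h} -> {for s, continuous (fun x => f x / h x)}.
Proof. by move=> h0 cf ch; apply: continuousM => //; exact: continuousV. Qed.

Let continuous_g (s : R) : {for s, continuous g}.
Proof. exact: derivable_continuous (dg s). Qed.

Let cstc (c s : R) : {for s, continuous (fun=> c)}.
Proof. exact: cst_continuous. Qed.

Let continuous_dPhi sg s : 0 < s -> 0 < W sg s -> {for s, continuous (dPhi sg)}.
Proof.
move=> s0 W0; have s1 : s != 0 by rewrite gt_eqF.
have cV := derivable_continuous (is_derive_V s0).
have cW := derivable_continuous (is_derive_W sg s0).
have cid : {for s, continuous (@idfun R)} by exact: cvg_id.
have cWp : {for s, continuous (fun x => W sg x `^ (1 - p))}.
  exact: (continuous_comp cW (@continuous_powR (1 - p) _ W0)).
have cgs : {for s, continuous (fun x => g' x - k * g x / x)}.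
  apply: continuousB; first exact: cg'.
  by apply: continuous_divr => //; apply: continuousM.
apply: continuousD; apply: continuousM => //; apply: continuousM => //.
  apply: continuousM; first by apply: continuousM; [exact: continuous_powR|exact: continuous_S].
  apply: continuousB; first exact: cg'.
  by apply: continuous_divr => //; apply: continuousM => //; apply: continuousM.
apply: continuousM => //; apply: continuousM.
  by apply: continuousM => //; exact: continuous_S.
apply: continuousB.
  by apply: continuousM => //; exact: continuous_powR.
apply: continuous_divr => //; first by rewrite gt_eqF.
apply: continuousM; first exact: continuousM.
exact: continuous_divr.
Qed.

Let continuous_B sg s : 0 < s -> 0 < W sg s -> {for s, continuous B}.
Proof.
move=> s0 W0; have p0 : 0 <= p by move: p2; lra.
have sp0 : 0 < s `^ p by exact: powR_gt0.
have l0 : `|ln (r * s)| `^ p != 0.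
  rewrite gt_eqF// powR_gt0// normr_gt0; apply/eqP => l0.
  by move: W0; rewrite /W l0 mulr0 ltxx.
have cl := derivable_continuous (is_derive_ln_scaled r0 s0).
apply: continuousD; apply: continuousM => //; apply: continuous_divr.
- by rewrite gt_eqF.
- exact: continuous_norm_comp.
- exact: continuous_powR.
- by rewrite mulf_neq0// gt_eqF.
- apply: continuous_norm_comp => //; apply: continuousB => //.
  by apply: continuousM => //; apply: continuousM => //; exact: continuous_powR.
- by apply: continuousM; [exact: continuous_powR|exact: continuous_norm_comp].
Qed.

Let continuous_A s : {for s, continuous A}.
Proof. apply: continuous_norm_comp; [move: p2; lra|exact: cg']. Qed.

(** Positivity of [W sg] keeps [1 / r] out of the segment, so all integrands are continuous there
    and the fundamental theorem of calculus applies to [Phi sg]. *)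
Lemma hardy_segment sg a b : (sg == 1) || (sg == -1) -> 0 < a -> a < b ->
  {in `[a, b], forall s, 0 < W sg s} ->
  (\int[lebesgue_measure]_(s in `[a, b]) (B s)%:E + (Phi sg b - Phi sg a)%:E <=
   \int[lebesgue_measure]_(s in `[a, b]) (A s)%:E)%E.
Proof.
move=> sg1 a0 ab Wab.
have pos s : s \in `[a, b] -> 0 < s.
  by rewrite in_itv/= => /andP[as_ _]; exact: lt_le_trans as_.
have within (f : R -> R) : (forall s, 0 < s -> 0 < W sg s -> {for s, continuous f}) ->
    {within `[a, b], continuous f}.
  move=> cf; apply: continuous_in_subspaceT => s; rewrite inE /= => sab.
  by apply: cf; [exact: pos|exact: Wab].
have cD := within _ (@continuous_dPhi sg).
have cB := within _ (@continuous_B sg).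
have cA := within _ (fun s _ _ => @continuous_A s).
have abcl : a \in `[a, b] /\ b \in `[a, b] by rewrite !in_itv/= !lexx (ltW ab).
have dP s : s \in `[a, b] -> is_derive s (1 : R) (Phi sg) (dPhi sg s).
  by move=> sab; apply: is_derive_Phi; [exact: pos|exact: Wab].
have cP s : s \in `[a, b] -> {for s, continuous (Phi sg)}.
  move=> sab; apply: differentiable_continuous; apply/derivable1_diffP.
  by have [] := dP s sab.
have FTC : (\int[lebesgue_measure]_(s in `[a, b]) (dPhi sg s)%:E =
    (Phi sg b)%:E - (Phi sg a)%:E)%E.
  apply: continuous_FTC2 => //.
    split.
    - by move=> s /subset_itv_oo_cc sab; have [] := dP s sab.
    - by apply: cvg_at_right_filter; apply: cP; case: abcl.
    - by apply: cvg_at_left_filter; apply: cP; case: abcl.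
  move=> s /subset_itv_oo_cc sab; rewrite derive1E.
  by have [_ ->] := dP s sab.
have iD := continuous_compact_integrable (segment_compact (a := a) (b := b)) cD.
have iB := continuous_compact_integrable (segment_compact (a := a) (b := b)) cB.
have iA := continuous_compact_integrable (segment_compact (a := a) (b := b)) cA.
rewrite EFinB -FTC -integralD//.
apply: le_integral => //; first exact: integrableD.
move=> s; rewrite inE/= => sab; rewrite -EFinD lee_fin.
by apply: le_A => //; [exact: pos|exact: Wab].
Qed.

Let measurable_cont (f : R -> R) : continuous f -> measurable_fun setT f.
Proof. exact: continuous_measurable_fun. Qed.

Let mg : measurable_fun setT g.
Proof. by apply: measurable_cont => s; exact: continuous_g. Qed.

Let mA : measurable_fun setT A.
Proof.
apply: (measurableT_comp (@measurable_powR R p)).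
by apply: measurableT_comp => //; exact: measurable_cont.
Qed.

Let mB : measurable_fun setT B.
Proof.
have mpow q : measurable_fun setT (fun s : R => s `^ q) by exact: measurable_powR.
have mnp (f : R -> R) : measurable_fun setT f -> measurable_fun setT (fun s => `|f s| `^ p).
  by move=> mf; apply: (measurableT_comp (mpow p)); exact: measurableT_comp.
have ml : measurable_fun setT (fun s : R => ln (r * s)).
  by apply: measurableT_comp => //; exact: measurable_funM.
apply: measurable_funD; apply: measurable_funM => //; apply: measurable_fun_divr => //.
- by move=> s; exact: powR_ge0.
- exact: mnp.
- by move=> s; rewrite mulr_ge0 ?powR_ge0.
- apply: mnp; apply: measurable_funB => //; apply: measurable_funM => //.
  exact: measurable_funM.
- by apply: measurable_funM => //; exact: mnp.
Qed.

Let k0 : 0 <= k.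
Proof. by apply: divr_ge0; move: p2; lra. Qed.

Let cp0 : 0 < cp p. Proof. exact: cp_gt0. Qed.

Let A0 s : (0 <= (A s)%:E)%E. Proof. by rewrite lee_fin powR_ge0. Qed.

Let B0 s : (0 <= (B s)%:E)%E.
Proof.
rewrite lee_fin; apply: addr_ge0; apply: mulr_ge0.
- exact: powR_ge0.
- by apply: divr_ge0; exact: powR_ge0.
- by apply: mulr_ge0; [exact: ltW|exact: powR_ge0].
- by apply: divr_ge0; [exact: powR_ge0|apply: mulr_ge0; exact: powR_ge0].
Qed.

Let q := r^-1.

Let q0 : 0 < q. Proof. by rewrite invr_gt0. Qed.

(* [T = |L| * |V / L|^p] for [L = ln (r * s)]; at [s = q] both [V] and [L]
   vanish, so [V / L] tends to a quotient of derivatives. *)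
Let T_cvg0 : T (h + q) @[h --> (0 : R)^'] --> (0 : R).
Proof.
have Vq : V q = 0.
  by rewrite /V /q powR_invr ?(ltW r0)// powRN invrK subrr.
have rq : r * q = 1 by rewrite divff// gt_eqF.
have lq : ln (r * q) = 0 by rewrite rq ln1.
have FF : Filter (0 : R)^' by exact: _.
have slope (f : R -> R) (df : R) : f q = 0 -> is_derive q (1 : R) f df ->
    h^-1 * f (h + q) @[h --> (0 : R)^'] --> df.
  move=> f0 [df1 <-]; move: df1; rewrite /derivable /derive => df1.
  rewrite [X in X @ _ --> _](_ : _ = (fun h => h^-1 *: ((f \o shift q) (h *: (1 : R)) - f q))).
    exact: df1.
  by apply/funext => h; rewrite /= [h *: 1]mulr1 f0 subr0.
have c1 := slope _ _ Vq (is_derive_V q0).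
have c2 := slope _ _ lq (is_derive_ln_scaled r0 q0).
have c3 : h^-1 * V (h + q) / (h^-1 * ln (r * (h + q)))
    @[h --> (0 : R)^'] --> V' q / q^-1.
  by apply: cvgM => //; apply: cvgV => //; rewrite invr_neq0// gt_eqF.
have {}c3 : `|h^-1 * V (h + q) / (h^-1 * ln (r * (h + q)))| `^ p
    @[h --> (0 : R)^'] --> `|V' q / q^-1| `^ p.
  have p0 : 0 <= p by move: p2; lra.
  have := continuous_cvg FF (@continuous_norm_powR R p p0 (V' q / q^-1)) c3.
  exact.
have c4 : `|ln (r * (h + q))| @[h --> (0 : R)^'] --> `|ln (r * q)|.
  have c6 : h @[h --> (0 : R)^'] --> (0 : R) by exact: cvg_within.
  have c5 : h + q @[h --> (0 : R)^'] --> q.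
    by rewrite -[q in X in _ --> X]add0r; apply: cvgD => //; exact: cvg_cst.
  have cl := derivable_continuous (is_derive_ln_scaled r0 q0).
  exact: cvg_norm (continuous_cvg _ cl c5).
rewrite lq normr0 in c4.
have := cvgM c4 c3; rewrite mul0r.
pose F h := `|ln (r * (h + q))| *
  `|h^-1 * V (h + q) / (h^-1 * ln (r * (h + q)))| `^ p.
rewrite -[X in X @ _ --> _]/F => c5.
suff nE : {near (0 : R)^', F =1 (fun h => T (h + q))}.
  exact: (cvg_trans (near_eq_cvg (FF := FF) nE) (c5 FF)).
rewrite /F.
near=> h.
have h0 : h != 0 by near: h; exact: nbhs_dnbhs_neq.
have nl : 0 < `|ln (r * (h + q))|.
  have hq : `|h| < q by near: h; exact: dnbhs0_lt.
  rewrite normr_gt0 ln_eq0.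
    by rewrite mulrDr rq addrC -subr_eq0 addrAC subrr add0r mulf_neq0// gt_eqF.
  by rewrite mulr_gt0// -ltrBlDr sub0r ltrNl (le_lt_trans _ hq)// ler_normr lexx orbT.
have ln0 : ln (r * (h + q)) != 0 by rewrite -normr_gt0.
have -> : h^-1 * V (h + q) / (h^-1 * ln (r * (h + q))) =
    V (h + q) / ln (r * (h + q)) by field; rewrite h0 ln0.
rewrite /T normrM normfV powRM ?invr_ge0// powR_invr// powRD; last first.
  by rewrite (gt_eqF nl) implybT.
by rewrite powRr1// powRN; ring.
Unshelve. all: by end_near. Qed.

(* The segments [E1 n] and [E2 n] exhaust [`]0, +oo[] minus [q]. The boundary terms
   at the outer endpoints have the right sign; those at [q -+ eta n] vanish in
   the limit, because [P] is continuous at [q] and [T] tends to [0] there. *)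
Let log_hardy_remainder1 a : 0 < a -> (forall s : R, s <= a -> g s = 0) ->
  (\int[lebesgue_measure]_(s in `]0%R, +oo[) (B s)%:E <=
   \int[lebesgue_measure]_(s in `]0%R, +oo[) (A s)%:E)%E.
Proof.
move=> a0 ga.
(* The bounds [eta <= q / 2], [al <= q / 4] and [be >= 2 q] keep both segments nondegenerate;
   [al <= a] makes [g], and with it [P], vanish at [al]. *)
pose eta n : R := q / 2 * n.+1%:R^-1.
pose al n : R := Num.min a (q / 4) * n.+1%:R^-1.
pose be n : R := 2 * q + n%:R.
have n1 n : 0 < (n.+1%:R^-1 : R) <= 1.
  by rewrite invr_gt0 ltr0Sn invf_le1// ler1n.
have eta0 n : 0 < eta n <= q / 2.
  have /andP[n0 n1'] := n1 n; rewrite /eta; have q20 : 0 < q / 2 by rewrite divr_gt0.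
  by rewrite mulr_gt0//= ger_pMr.
have m0 : 0 < Num.min a (q / 4) by rewrite lt_min a0 divr_gt0.
have al0 n : [/\ 0 < al n, al n <= a & al n <= q / 4].
  have /andP[n0 n1'] := n1 n.
  have le1 : al n <= Num.min a (q / 4) by rewrite /al ger_pMr.
  move: le1; rewrite le_min => /andP[? ?]; split => //; exact: mulr_gt0.
have be0 n : 2 * q <= be n by rewrite /be lerDl.
pose E1 n := [set` `[al n, q - eta n]].
pose E2 n := [set` `[q + eta n, be n]].
pose kp := k `^ (p - 1).
(* The [P] terms from the two sides of [q] have opposite signs and cancel in the limit. The [T]
   terms add up, since [sg] changes sign together with the role of the endpoint, so each of them has
   to tend to [0]. *)
pose err n := kp * (P (q + eta n) - P (q - eta n)) +
  cp p * kp * (T (q - eta n) + T (q + eta n)).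
have kp0 : 0 <= kp by exact: powR_ge0.
have ckp0 : 0 <= cp p * kp by rewrite mulr_ge0// ltW.
have P0 s : 0 <= P s by rewrite mulr_ge0 ?powR_ge0.
have T0 s : 0 <= T s by rewrite mulr_ge0 ?powR_ge0.
have Pz s : g s = 0 -> P s = 0.
  by move=> gs; rewrite /P gs normr0 powR0 ?mulr0//; apply/eqP; move: p2; lra.
have lnlt (s : R) : 0 < s -> s < q -> 0 < W (-1) s.
  move=> s0 sq; rewrite /W mulN1r oppr_gt0 ln_lt0// mulr_gt0//=.
  by rewrite -ltr_pdivlMl// mulr1.
have lngt s : q < s -> 0 < W 1 s.
  by move=> sq; rewrite /W mul1r ln_gt0// -ltr_pdivrMl// mulr1.
have seg1 n : (\int[lebesgue_measure]_(s in E1 n) (B s)%:E <=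
    \int[lebesgue_measure]_(s in E1 n) (A s)%:E +
    (cp p * kp * T (q - eta n) - kp * P (q - eta n))%:E)%E.
  have /andP[e0 e1] := eta0 n; have [a1 a2 a3] := al0 n.
  have Wpos : {in `[al n, q - eta n], forall s, 0 < W (-1) s}.
    by move=> s; rewrite in_itv/= => /andP[h1 h2]; apply: lnlt; lra.
  have := @hardy_segment (-1) (al n) (q - eta n) _ a1 _ Wpos.
  rewrite eqxx orbT => /(_ isT); have lt1 : al n < q - eta n by lra.
  move=> /(_ lt1); rewrite -leeBrDr// -EFinN => /le_trans; apply.
  rewrite leeD2l// lee_fin.
  have WT s : s \in `[al n, q - eta n] -> W (-1) s `^ (1 - p) * `|V s| `^ p = T s.
    move=> /Wpos W0; rewrite /T; congr (_ `^ _ * _).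
    by rewrite ler0_norm /W ?mulN1r//; move: W0; rewrite /W mulN1r oppr_gt0 => /ltW.
  rewrite /Phi !WT ?in_itv/= ?lexx ?(ltW lt1)// (Pz (al n)) ?ga//.
  by have := mulr_ge0 ckp0 (T0 (al n)); rewrite -/kp; lra.
have seg2 n : (\int[lebesgue_measure]_(s in E2 n) (B s)%:E <=
    \int[lebesgue_measure]_(s in E2 n) (A s)%:E +
    (cp p * kp * T (q + eta n) + kp * P (q + eta n))%:E)%E.
  have /andP[e0 e1] := eta0 n; have b1 := be0 n; have q0' := q0.
  have Wpos : {in `[q + eta n, be n], forall s, 0 < W 1 s}.
    by move=> s; rewrite in_itv/= => /andP[h1 h2]; apply: lngt; lra.
  have qe0 : 0 < q + eta n by lra.
  have lt1 : q + eta n < be n by lra.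
  have := @hardy_segment 1 (q + eta n) (be n) _ qe0 lt1 Wpos.
  rewrite eqxx => /(_ isT); rewrite -leeBrDr// -EFinN => /le_trans; apply.
  rewrite leeD2l// lee_fin.
  have WT s : s \in `[q + eta n, be n] -> W 1 s `^ (1 - p) * `|V s| `^ p = T s.
    move=> /Wpos W0; rewrite /T; congr (_ `^ _ * _).
    by rewrite ger0_norm /W ?mul1r//; move: W0; rewrite /W mul1r => /ltW.
  rewrite /Phi !WT ?in_itv/= ?lexx ?(ltW lt1)//.
  have := mulr_ge0 ckp0 (T0 (be n)); have := mulr_ge0 kp0 (P0 (be n)).
  by rewrite -/kp; lra.
pose E n := E1 n `|` E2 n.
have disj n : [disjoint E1 n & E2 n].
  have /andP[e0 e1] := eta0 n.
  by apply/disj_setPS => s []; rewrite /E1 /E2 /= !in_itv/= => /andP[? ?] /andP[? ?]; lra.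
have mE n : measurable (E n) by apply: measurableU; exact: measurable_itv.
have EI n : E n `<=` `]0, +oo[.
  have /andP[e0 e1] := eta0 n; have [a1 a2 a3] := al0 n; have q0' := q0.
  by move=> s []; rewrite /E1 /E2 /= !in_itv/= andbT => /andP[? ?]; lra.
have mBE D : measurable_fun D (fun s => (B s)%:E).
  by apply: measurable_funTS; exact/measurable_EFinP.
have mAE D : measurable_fun D (fun s => (A s)%:E).
  by apply: measurable_funTS; exact/measurable_EFinP.
have splitE n (f : R -> R) : measurable_fun (E n) (fun s => (f s)%:E) ->
    (forall s, (0 <= (f s)%:E)%E) ->
    (\int[lebesgue_measure]_(s in E n) (f s)%:E =
     \int[lebesgue_measure]_(s in E1 n) (f s)%:E +
     \int[lebesgue_measure]_(s in E2 n) (f s)%:E)%E.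
  by move=> mf f0; apply: ge0_integral_setU => //; exact: measurable_itv.
(* On the right the domain is enlarged to the whole half-line at once, so only the integral of [B]
   needs monotone convergence. *)
have leE n : (\int[lebesgue_measure]_(s in E n) (B s)%:E <=
    \int[lebesgue_measure]_(s in `]0%R, +oo[) (A s)%:E + (err n)%:E)%E.
  have := ge0_subset_integral lebesgue_measure (mE n) (measurable_itv _) (mAE _) (fun s _ => A0 s) (EI n).
  move=> /(leeD2r (err n)%:E); apply: le_trans.
  rewrite (splitE n B)// (splitE n A)//.
  apply: le_trans (leeD (seg1 n) (seg2 n)) _.
  rewrite addeACA -EFinD leeD2l// lee_fin /err; lra.
have ceta : eta n @[n --> \oo] --> (0 : R).
  rewrite -[0](mulr0 (q / 2)); apply: cvgM; first exact: cvg_cst.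
  exact: cvg_harmonic.
have cPq (u : R ^nat) : u n @[n --> \oo] --> q -> P (u n) @[n --> \oo] --> P q.
  move=> cu; have cP : {for q, continuous P}.
    apply: continuousM; first exact: continuous_powR.
    by apply: continuous_norm_comp => //; move: p2; lra.
  exact: (continuous_cvg _ cP cu).
have cT := (cvgr_dnbhsP (fun h => T (h + q)) 0 0).1 T_cvg0.
have cerr : err n @[n --> \oo] --> (0 : R).
  have -> : 0 = kp * (P q - P q) + cp p * kp * (0 + 0) :> R by ring.
  apply: cvgD; apply: cvgM; try exact: cvg_cst.
    apply: cvgB; apply: cPq.
      by rewrite -[q in X in _ --> X]addr0; apply: cvgD => //; exact: cvg_cst.
    by rewrite -[q in X in _ --> X]subr0; apply: cvgB => //; exact: cvg_cst.
  apply: cvgD.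
    rewrite (_ : (fun n => _) = (fun n => T (- eta n + q))); last first.
      by apply/funext => n; rewrite addrC.
    apply: (cT (fun n => - eta n)); split.
      by move=> n; rewrite oppr_eq0 gt_eqF//; case/andP: (eta0 n).
    by rewrite -oppr0; exact: cvgN.
  rewrite (_ : (fun n => _) = (fun n => T (eta n + q))); last first.
    by apply/funext => n; rewrite addrC.
  apply: (cT eta); split => // n.
  by rewrite gt_eqF//; case/andP: (eta0 n).
have Emono : {homo E : n m / (n <= m)%N >-> (n <= m)%O}.
  move=> n m nm; apply/subsetPset.
  have le_inv : (m.+1%:R^-1 : R) <= n.+1%:R^-1.
    by rewrite lef_pV2 ?posrE// ler_nat ltnS.
  have em : eta m <= eta n by rewrite /eta ler_pM2l// divr_gt0.
  have am : al m <= al n by rewrite /al ler_pM2l.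
  have bm : be n <= be m by rewrite /be lerD2l ler_nat.
  move=> s []; rewrite /E /E1 /E2 /= !in_itv/= => /andP[h1 h2]; [left|right];
    by apply/andP; split; lra.
have EU : \bigcup_n E n = `]0, +oo[ `\ q.
  apply/seteqP; split => [s [n _ En]|s [/= + sq]].
    split; first exact: EI En.
    have /andP[e0 e1] := eta0 n; move=> /= sq; move: En; rewrite sq.
    by case; rewrite /E1 /E2/= in_itv/= => /andP[? ?]; lra.
  rewrite in_itv/= andbT => s0.
  have ds : 0 < `|s - q| by rewrite normr_gt0 subr_eq0; apply/eqP.
  have cal : al n @[n --> \oo] --> (0 : R).
    rewrite -[0](mulr0 (Num.min a (q / 4))); apply: cvgM; first exact: cvg_cst.
    exact: cvg_harmonic.
  have near_n : \forall n \near \oo, [/\ eta n <= `|s - q|, al n <= s & s <= be n].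
    near=> n; split.
    - by near: n; exact: (cvgr_le _ ceta).
    - by near: n; exact: (cvgr_le _ cal).
    - have h : s <= n%:R by near: n; exact: nbhs_infty_ger.
      by rewrite /be; have := q0; lra.
  have [n [h1 h2 h3]] := filter_ex near_n.
  exists n => //; have [sq'|sq'] := ltP s q; [left|right]; rewrite /E1 /E2/= in_itv/=.
    by move: h1; rewrite ltr0_norm ?subr_lt0//; lra.
  by move: h1; rewrite ger0_norm ?subr_ge0//; lra.
have cE : (\int[lebesgue_measure]_(s in E n) (B s)%:E)%E @[n --> \oo] -->
    (\int[lebesgue_measure]_(s in \bigcup_n E n) (B s)%:E)%E.
  by apply: ge0_nondecreasing_set_cvg_integral => // n; exact: mBE.
have mD : measurable ([set` `]0%R, +oo[] `\ q) by apply: measurableD.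
rewrite EU (integral_setD1 mD (mBE _)) in cE.
apply/lee_addgt0Pr => e e0.
apply: (cvge_le _ cE); near=> n.
apply: le_trans (leE n) _; rewrite leeD2l// lee_fin.
by near: n; exact: (cvgr_le _ cerr).
Unshelve. all: by end_near. Qed.

(** The factor [c] makes room for the angular weight, a power of [psi], which is constant along each
    ray. *)
Lemma log_hardy_remainder c a : 0 <= c -> 0 < a ->
  (forall s : R, s <= a -> g s = 0) ->
  (\int[lebesgue_measure]_(s in `]0%R, +oo[) (c * B s)%:E <=
   \int[lebesgue_measure]_(s in `]0%R, +oo[) (c * A s)%:E)%E.
Proof.
move=> c0 a0 ga.
have Zl (f : R -> R) : measurable_fun setT f -> (forall s, (0 <= (f s)%:E)%E) ->
    (\int[lebesgue_measure]_(s in `]0%R, +oo[) (c * f s)%:E =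
     c%:E * \int[lebesgue_measure]_(s in `]0%R, +oo[) (f s)%:E)%E.
  move=> mf f0; under eq_integral do rewrite EFinM.
  rewrite ge0_integralZl//.
  by apply: measurable_funTS; exact/measurable_EFinP.
rewrite (Zl B)// (Zl A)//.
by rewrite lee_wpmul2l ?lee_fin//; exact: log_hardy_remainder1 ga.
Qed.

End hardy_segment.

(** * Differentiation along rays and the gradient of the gauge *)

Section grushin_calculus.
Context {R : realType} {n : nat}.
Implicit Types (u f : 'rV[R]_n * R -> R) (z w : 'rV[R]_n * R).

(** [rho] times [partial_rho u]: the derivative along the generator [(x, 2 t)] of the dilations. For
    smooth [u] it is continuous also at the origin. *)
Definition radial u z : R :=
  \sum_i z.1 ord0 i * grad_x u z ord0 i + 2 * z.2 * partial_t u z.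

Lemma diff_radial u z : differentiable u z ->
  'd u z (z.1, 2 * z.2) = radial u z.
Proof.
move=> du; rewrite /radial /partial_t deriveE//.
have -> : (z.1, 2 * z.2) = \sum_i (z.1 ord0 i *: (delta_mx ord0 i, 0 : R)) +
    (2 * z.2) *: ((0, 1) : 'rV[R]_n * R).
  have fstE (I : seq 'I_n) (F : 'I_n -> 'rV[R]_n * R) :
      \sum_(i <- I) F i = (\sum_(i <- I) (F i).1, \sum_(i <- I) (F i).2).
    by elim/big_rec3 : _ => // i a b c _ ->.
  rewrite fstE; congr pair => /=.
    by rewrite scaler0 addr0 -row_sum_delta.
  rewrite big1 => [|i _]; last exact: mulr0.
  by rewrite add0r [RHS]mulr1.
rewrite linearD linear_sum linearZ/=; congr (_ + _).
by apply: eq_bigr => i _; rewrite linearZ/= mxE deriveE.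
Qed.

Let is_derive_expRN (s : R) : is_derive s (1 : R) (fun s => expR (- s)) (- expR (- s)).
Proof.
have d := is_derive1_comp (is_derive_expR (- s)) (is_deriveN (is_derive_id s (1 : R))).
by apply: is_derive_eq d _; rewrite mulrN1.
Qed.

Let is_derive_expRN2 (s : R) :
  is_derive s (1 : R) (fun s => expR (- s) ^+ 2) (- (2 * expR (- s) ^+ 2)).
Proof.
have d := is_derive_expRN s.
apply: is_derive_eq (is_deriveM d d) _.
transitivity (expR (- s) * - expR (- s) + expR (- s) * - expR (- s)) => //; ring.
Qed.

Let differentiable_ray (x : 'rV[R]_n) (t s : R) :
  differentiable (fun s => expR (- s) *: x) s /\
  differentiable (fun s => expR (- s) ^+ 2 *: (t : R^o)) s.
Proof.
by split; apply: differentiableZl; apply/derivable1_diffP;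
  [have [] := is_derive_expRN s|have [] := is_derive_expRN2 s].
Qed.

(** The ray has velocity [- (x, 2 t)] at its point [(x, t)], so the chain rule reduces this to
    [diff_radial]. *)
Lemma is_derive_ray u w s : differentiable u (dil (expR (- s)) w) ->
  is_derive s 1 (fun s => u (dil (expR (- s)) w)) (- radial u (dil (expR (- s)) w)).
Proof.
move=> du; pose a (s : R) : R := expR (- s).
have [d1 d2] := differentiable_ray w.1 w.2 s.
have [/derivable1_diffP fa da] := is_derive_expRN s.
have [/derivable1_diffP fa2 da2] := is_derive_expRN2 s.
pose gam s : 'rV[R]_n * R^o := (a s *: w.1, a s ^+ 2 *: (w.2 : R^o)).
have dg : differentiable gam s by exact: differentiable_pair d1 d2.
have dc := differentiable_comp dg du.
have dgE : 'd gam s 1 = (- a s *: w.1, - (2 * a s ^+ 2) *: (w.2 : R^o)).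
  rewrite (diff_pair d1 d2) !diffZl// !diff1E// !derive1E.
  by rewrite da da2 ![1 *: _]mul1r.
split; first exact/derivable1_diffP.
transitivity ('d (u \o gam) s 1); first by rewrite -deriveE.
rewrite diff_comp//= dgE -diff_radial//.
rewrite -linearN; congr ('d u _ _).
congr pair; rewrite /= scaleNr//.
by congr (- _); rewrite mulrA.
Qed.

Let continuous_coord1 i : continuous (fun z : 'rV[R]_n * R => z.1 ord0 i).
Proof.
move=> z; apply: (@continuous_comp _ _ _ fst (fun x : 'rV[R]_n => x ord0 i)).
  exact: cvg_fst.
exact: coord_continuous.
Qed.

Let continuous_coord2 : continuous (fun z : 'rV[R]_n * R => z.2).
Proof. by move=> z; exact: cvg_snd. Qed.

Let continuous_sum (I : Type) (s : seq I) (F : I -> 'rV[R]_n * R -> R) z :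
  (forall i, {for z, continuous (F i)}) ->
  {for z, continuous (fun z => \sum_(i <- s) F i z)}.
Proof.
move=> cF; elim: s => [|i s IH].
  rewrite (_ : (fun _ => _) = cst 0); first exact: cst_continuous.
  by apply/funext => y; rewrite big_nil.
rewrite (_ : (fun _ => _) = (fun z => F i z + \sum_(i <- s) F i z)); last first.
  by apply/funext => y; rewrite big_cons.
exact: continuousD.
Qed.

Lemma continuous_radial u : smooth u -> continuous (radial u).
Proof.
move=> su z; suff: {for z, continuous (fun z =>
  \sum_i z.1 ord0 i * grad_x u z ord0 i + 2 * z.2 * partial_t u z)} by [].
apply: continuousD.
  apply: continuous_sum => i; apply: continuousM; first exact: continuous_coord1.
  rewrite (_ : (fun _ => _) = 'D_(delta_mx ord0 i, 0) u); last first.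
    by apply/funext => y; rewrite mxE.
  exact: differentiable_continuous (su [:: (delta_mx ord0 i, 0)] z).
apply: continuousM; last exact: differentiable_continuous (su [:: (0, 1)] z).
apply: continuousM; first exact: cst_continuous.
exact: continuous_coord2.
Qed.

Lemma continuous_dil w : continuous (fun s : R => dil (expR (- s)) w).
Proof.
move=> s; have [d1 d2] := differentiable_ray w.1 w.2 s.
exact: differentiable_continuous (differentiable_pair d1 d2).
Qed.

(** The fourth power is a polynomial in the coordinates, and it has the same extremal points on a
    compact set as [rho]. *)
Lemma continuous_rhoX4 : continuous (fun z : 'rV[R]_n * R => rho z ^+ 4).
Proof.
pose S z := \sum_i z.1 ord0 i ^+ 2.
have cS z : {for z, continuous S}.
  apply: continuous_sum => i.
  by apply: continuousM; exact: continuous_coord1.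
suff rE z : rho z ^+ 4 = S z * S z + 4 * (z.2 * z.2).
  move=> z; rewrite (_ : (fun z => rho z ^+ 4) =
    (fun z => S z * S z + 4 * (z.2 * z.2))); last exact/funext/rE.
  suff : {for z, continuous (fun z => S z * S z + 4 * (z.2 * z.2))} by [].
  apply: continuousD; first exact: continuousM (cS z) (cS z).
  apply: continuousM; first exact: cst_continuous.
  by apply: continuousM; exact: continuous_coord2.
by rewrite rhoX4 /S -sqr_enorm; ring.
Qed.

End grushin_calculus.

(** * The Grushin gradient of the gauge *)

Section gradient_of_rho.
Context {R : realType} {n : nat}.
Implicit Types (u f : 'rV[R]_n * R -> R) (z w v : 'rV[R]_n * R).

(** Reduces the partial derivatives of [rho] to one variable: on a coordinate line [rho] is the
    fourth root of an explicit polynomial. *)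
Let derive_line f z v :
  'D_v f z = 'D_(1 : R) (fun h : R => f (h *: v + z)) 0.
Proof.
apply: (congr1 (fun F : R -> R => lim (F @ (0 : R)^'))); apply/funext => h /=.
by rewrite addr0 [h *: 1]mulr1 scale0r add0r.
Qed.

Let is_derive_root (N : R -> R) (dN : R) : 0 < N 0 ->
  is_derive (0 : R) (1 : R) N dN ->
  'D_(1 : R) (fun h => N h `^ 4^-1) 0 = dN / (4 * (N 0 `^ 4^-1) ^+ 3).
Proof.
move=> N0 dN0; have d := is_derive1_comp (is_derive1_powR 4^-1 N0) dN0.
have [_ ->] := d.
have -> : N 0 `^ (4^-1 - 1) = ((N 0 `^ 4^-1) ^+ 3)^-1.
  rewrite -powR_mulrn ?powR_ge0// -powRrM -powRN; congr powR; by field.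
have y0 : N 0 `^ 4^-1 != 0 by rewrite gt_eqF// powR_gt0.
by field.
Qed.

Let sqX (x : 'rV[R]_n) : R := \sum_i x ord0 i ^+ 2.

Let rhoE z : rho z = (sqX z.1 ^+ 2 + 4 * z.2 ^+ 2) `^ 4^-1.
Proof. by rewrite /rho /sqX -sqr_enorm -exprM. Qed.

Let rhoX4E z : rho z ^+ 4 = sqX z.1 ^+ 2 + 4 * z.2 ^+ 2.
Proof. by rewrite rhoX4 /sqX -sqr_enorm -exprM. Qed.

Let grad_x_rho z i : 0 < rho z ->
  grad_x rho z ord0 i = sqX z.1 * z.1 ord0 i / rho z ^+ 3.
Proof.
move=> r0; rewrite mxE derive_line.
set x := z.1 ord0 i; set S := sqX z.1; set t := z.2.
have NE h : rho (h *: (delta_mx ord0 i, 0) + z) =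
    ((S + 2 * x * h + h ^+ 2) ^+ 2 + 4 * t ^+ 2) `^ 4^-1.
  rewrite rhoE/= [h *: 0]mulr0 add0r -/t; congr ((_ ^+ 2 + _) `^ _).
  rewrite /S /sqX (bigD1 i)//= [in RHS](bigD1 i)//= !mxE !eqxx mulr1 -/x.
  under eq_bigr => j ji do rewrite !mxE (negbTE ji) andbF mulr0 add0r.
  by ring.
rewrite (_ : (fun h => _) = (fun h => ((S + 2 * x * h + h ^+ 2) ^+ 2 + 4 * t ^+ 2) `^ 4^-1));
  last exact/funext/NE.
pose N (h : R) := (S + 2 * x * h + h ^+ 2) ^+ 2 + 4 * t ^+ 2.
have N0E : N 0 = rho z ^+ 4.
  by rewrite rhoX4E /N; congr (_ ^+ 2 + _); rewrite -/S; ring.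
have dN : is_derive (0 : R) (1 : R) N (4 * S * x).
  have di := is_derive_id (0 : R) (1 : R).
  have dc (c : R) := is_derive_cst c (0 : R) (1 : R).
  have d1 := is_deriveD (is_deriveD (dc S) (is_deriveZ (2 * x) di)) (is_deriveM di di).
  apply: is_derive_eq (is_deriveD (is_deriveM d1 d1) (dc (4 * t ^+ 2))) _.
  transitivity ((S + 2 * x * 0 + 0 * 0) * (0 + 2 * x * 1 + (0 * 1 + 0 * 1)) +
    (S + 2 * x * 0 + 0 * 0) * (0 + 2 * x * 1 + (0 * 1 + 0 * 1)) + 0) => //.
  ring.
have N0 : 0 < N 0 by rewrite N0E exprn_gt0.
rewrite (is_derive_root N0 dN).
have -> : rho z = (N 0) `^ 4^-1.
  by rewrite N0E -powR_mulrn ?rho_ge0// -powRrM mulfV// powRr1// rho_ge0.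
by field; rewrite gt_eqF// powR_gt0.
Qed.

Let partial_t_rho z : 0 < rho z -> partial_t rho z = 2 * z.2 / rho z ^+ 3.
Proof.
move=> r0; rewrite /partial_t derive_line.
set S := sqX z.1; set t := z.2.
have NE h : rho (h *: (0, 1) + z) = (S ^+ 2 + 4 * (h + t) ^+ 2) `^ 4^-1.
  by rewrite rhoE/= scaler0 add0r [h *: 1]mulr1.
rewrite (_ : (fun h => _) = (fun h => (S ^+ 2 + 4 * (h + t) ^+ 2) `^ 4^-1));
  last exact/funext/NE.
pose N (h : R) := S ^+ 2 + 4 * (h + t) ^+ 2.
have N0E : N 0 = rho z ^+ 4 by rewrite rhoX4E /N add0r.
have dN : is_derive (0 : R) (1 : R) N (8 * t).
  have di := is_derive_id (0 : R) (1 : R).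
  have dc (c : R) := is_derive_cst c (0 : R) (1 : R).
  have d1 := is_deriveD di (dc t).
  apply: is_derive_eq (is_deriveD (dc (S ^+ 2)) (is_deriveZ 4 (is_deriveM d1 d1))) _.
  transitivity (0 + 4 * ((0 + t) * (1 + 0) + (0 + t) * (1 + 0))) => //.
  ring.
have N0 : 0 < N 0 by rewrite N0E exprn_gt0.
rewrite (is_derive_root N0 dN).
have -> : rho z = (N 0) `^ 4^-1.
  by rewrite N0E -powR_mulrn ?rho_ge0// -powRrM mulfV// powRr1// rho_ge0.
by field; rewrite gt_eqF// powR_gt0.
Qed.

(** The squared norm is [|x|^2 (|x|^4 + 4 t^2) / rho^6], and the bracket is [rho^4]. *)
Lemma grushin_grad_norm_rho z : 0 < rho z ->
  grushin_grad_norm rho z = Num.sqrt (psi z).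
Proof.
move=> r0; rewrite /grushin_grad_norm /grushin_grad; congr Num.sqrt => /=.
rewrite exprMn !sqr_enorm partial_t_rho// /psi sqr_enorm -/(sqX z.1).
under eq_bigr => i _ do rewrite grad_x_rho// mulrAC exprMn.
rewrite -mulr_sumr -/(sqX z.1) exprMn.
have -> : sqX z.1 * (2 * z.2 / rho z ^+ 3) ^+ 2 =
    sqX z.1 * (4 * z.2 ^+ 2) / (rho z ^+ 3) ^+ 2.
  by field; rewrite gt_eqF// exprn_gt0.
have -> : 4 * z.2 ^+ 2 = rho z ^+ 4 - sqX z.1 ^+ 2 by rewrite rhoX4E; ring.
by field; rewrite gt_eqF.
Qed.

Lemma enorm_le_rho z : enorm z.1 <= rho z.
Proof.
have h : enorm z.1 ^+ 4 <= rho z ^+ 4.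
  by rewrite rhoX4 lerDl; apply: mulr_ge0 => //; exact: sqr_ge0.
by move: h; rewrite ler_pXn2r ?nnegrE ?enorm_ge0 ?rho_ge0.
Qed.

Lemma psi_le1 z : 0 < rho z -> psi z <= 1.
Proof.
move=> r0; rewrite /psi ler_pdivrMr; last exact: exprn_gt0.
by rewrite mul1r ler_pXn2r ?nnegrE ?enorm_ge0 ?rho_ge0 ?enorm_le_rho.
Qed.

End gradient_of_rho.

(** * Measure of the ball and bounds for test functions *)

Section gauge_ball_facts.
Context {R : realType} {n : nat}.
Local Notation G := ('rV[R]_n * measurableTypeR R)%type.
Implicit Types (z w : 'rV[R]_n * R) (u : 'rV[R]_n * R -> R).

Lemma measurable_gauge_ball (r : R) : measurable (gauge_ball r : set G).
Proof.
rewrite (_ : gauge_ball r = rho @^-1` `]-oo, r[).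
  by rewrite -[X in measurable X]setTI; exact: measurable_rho.
by apply/seteqP; split => z; rewrite /gauge_ball /= in_itv.
Qed.

(** The ball lies in the cube with sides [[-1, 1]], whose measure is a finite product of finite
    lengths. *)
Lemma gauge_ball_lty : (lebesgue_grushin R n (gauge_ball 1) < +oo)%E.
Proof.
pose I : set R := [set` `[-1, 1]].
pose D : set 'rV[R]_n := [set v | forall i, I (v ord0 i)].
have mI : measurable I by exact: measurable_itv.
have Ifin : (lebesgue_measure I < +oo)%E.
  by rewrite lebesgue_measure_itv/= lte_fin; case: ifP => _; rewrite ltry.
have mD : measurable D.
  rewrite (_ : D = \big[setI/setT]_(i < n) (rV_coord i @^-1` I)).
    apply: bigsetI_measurable => i _.
    by rewrite -[X in measurable X]setTI; exact: measurable_rV_coord.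
  rewrite -bigcap_seq; apply/seteqP; split => v /= h i.
    by move=> _; exact: h.
  by apply: (h i); rewrite /= mem_index_enum.
have sqr_le (x : R) : x ^+ 2 <= 1 -> I x.
  move=> x1; rewrite /I /= in_itv/= -ler_norml.
  by rewrite -(@ler_pXn2r _ 2)// ?nnegrE// expr1n real_normK ?num_real.
have sub : gauge_ball 1 `<=` D `*` I.
  move=> z zb; have r4 : rho z ^+ 4 <= 1 by rewrite exprn_ile1 ?rho_ge0// ltW.
  have e4 : enorm z.1 ^+ 4 <= 1.
    by apply: le_trans r4; rewrite rhoX4 lerDl mulr_ge0// sqr_ge0.
  have e2 : enorm z.1 ^+ 2 <= 1.
    by rewrite -(@ler_pXn2r _ 2)// ?nnegrE ?sqr_ge0// expr1n -exprM.
  split => /=.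
    move=> i; apply: sqr_le; apply: le_trans e2; rewrite sqr_enorm (bigD1 i)//=.
    by rewrite lerDl sumr_ge0// => j _; exact: sqr_ge0.
  apply: sqr_le; have : 4 * z.2 ^+ 2 <= 1.
    by apply: le_trans r4; rewrite rhoX4 lerDr exprn_ge0// enorm_ge0.
  by have := sqr_ge0 z.2; lra.
apply: (@le_lt_trans _ _ (lebesgue_grushin R n (D `*` I))).
  apply: le_measure => //; rewrite inE; first exact: measurable_gauge_ball.
  exact: measurableX.
rewrite /lebesgue_grushin product_measure1E// lte_mul_pinfty//.
suff : (\prod_(i < n) @lebesgue_measure R I)%E \is a fin_num.
  by rewrite -(@lebesgue_rV_box R n (fun=> I)).
apply: (big_ind (fun x : \bar R => x \is a fin_num)) => //.
  by move=> x y; exact: fin_numM.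
by move=> i _; rewrite ge0_fin_numE.
Qed.

(** Extreme values on the compact support: it avoids the origin and the sphere [rho = 1], so [rho]
    stays away from [0] and [1] on it. *)
Lemma test_function_bounds u :
  test_function (gauge_ball 1 `\` [set (0, 0)]) u ->
  exists a b M : R, [/\ 0 < a, 0 < b < 1,
    forall z, u z != 0 -> a <= rho z <= b & forall z, `|u z| <= M].
Proof.
move=> [su cu subu].
have [[z0 uz0]|u0] := pselect (exists z, u z != 0); last first.
  exists 2^-1, 2^-1, 0; split => [//||z uz|z].
  - by apply/andP; split; lra.
  - by exfalso; apply: u0; exists z.
  - by have [->|uz] := eqVneq (u z) 0; [rewrite normr0|exfalso; apply: u0; exists z].
have usupp z : u z != 0 -> supp u z by move=> uz; exact: subset_closure.
have supp0 : supp u !=set0 by exists z0; exact: usupp.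
have c4 : {within supp u, continuous (fun z => rho z ^+ 4)}.
  exact: continuous_subspaceT (@continuous_rhoX4 R n).
have cun : {within supp u, continuous (fun z => `|u z|)}.
  apply: continuous_subspaceT => z; apply: continuous_comp; last exact: norm_continuous.
  exact: differentiable_continuous (su [::] z).
have [c1 c1s c1m] := compact_EVT_min supp0 cu c4.
have [c2 c2s c2m] := compact_EVT_max supp0 cu c4.
have [c3 c3s c3m] := compact_EVT_max supp0 cu cun.
have srho z : z \in supp u -> 0 < rho z < 1.
  rewrite inE => /subu[zb /= z00]; rewrite zb andbT lt_neqAle rho_ge0 andbT.
  by rewrite eq_sym rho_eq0; apply/eqP.
exists (rho c1), (rho c2), `|u c3|; split.
- by case/andP: (srho _ c1s).
- exact: srho.
- move=> z /usupp zs; have zs' : z \in supp u by rewrite inE.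
  have := c1m z zs'; have := c2m z zs'.
  by rewrite !ler_pXn2r ?nnegrE ?rho_ge0// => -> ->.
- move=> z; have [->|uz] := eqVneq (u z) 0; first by rewrite normr0.
  by apply: c3m; rewrite inE; exact: usupp.
Qed.

End gauge_ball_facts.

(** * The inequality on the gauge ball *)

Section radial_hardy.
Context {R : realType} {n : nat}.
Variables (p : R) (u : 'rV[R]_n * R -> R).
Hypotheses (p2 : 2 <= p) (su : smooth u).
Local Notation G := ('rV[R]_n * measurableTypeR R)%type.
Implicit Types (z w : 'rV[R]_n * R).
Let Q := hom_dim R n.
Let k := (p - 1) / p.
Let mu := lebesgue_grushin R n.

Let Q0 : 0 < Q. Proof. by rewrite /Q /hom_dim ltr_wpDl// ler0n. Qed.

Let F1 z := radial_grad_norm u z `^ p / rho z `^ (Q - p).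
(** In [F2] and [F3] the gradient norm of [rho] is replaced by the square root of [psi], which is
    measurable by its formula and constant along rays. *)
Let F2 z := `|u z| `^ p * Num.sqrt (psi z) `^ p / (rho z `^ Q * ln (rho z)^-1 `^ p).
Let F3 r z := `|u z - ln (rho z)^-1 `^ k * r `^ k *
    u (dil (expR (- r^-1) / rho z) z)| `^ p /
  (rho z `^ Q * ln (rho z)^-1 `^ p * `|ln (r * ln (rho z)^-1)| `^ p) *
  Num.sqrt (psi z) `^ p.

Let mpow q (f : G -> R) : measurable_fun setT f -> measurable_fun setT (fun z => f z `^ q).
Proof. by move=> mf; exact: measurableT_comp (measurable_powR q) mf. Qed.

Let mu_ : measurable_fun setT (u : G -> R).
Proof.
apply: continuous_measurable_grushin => z.
exact: differentiable_continuous (su [::] z).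
Qed.

Let mpsi : measurable_fun setT (fun z : G => Num.sqrt (psi z)).
Proof.
have h := @continuous_measurable_fun R _ (@sqrt_continuous R).
apply: (measurableT_comp h); apply: measurable_fun_divr.
- by move=> z; exact: sqr_ge0.
- by apply: measurable_funX; exact: measurable_enorm.
- by apply: measurable_funX; exact: measurable_rho.
Qed.

Let mlnrho : measurable_fun setT (fun z : G => ln (rho z)^-1).
Proof.
apply: (measurableT_comp (@measurable_ln R)).
rewrite (_ : (fun z => _) = (fun z => 1 / rho z)); last first.
  by apply/funext => z; rewrite div1r.
by apply: measurable_fun_divr => //; [exact: rho_ge0|exact: measurable_rho].
Qed.

Let mnorm (f : G -> R) : measurable_fun setT f -> measurable_fun setT (fun z => `|f z|).
Proof. by move=> mf; exact: measurableT_comp. Qed.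

Let mF1 : measurable_fun setT (F1 : G -> R).
Proof.
apply: measurable_fun_divr; first by move=> z; exact: powR_ge0.
  apply: mpow; apply: measurable_funM => //; apply: mnorm.
  rewrite (_ : partial_rho u = (fun z => radial u z / rho z)); last first.
    by apply/funext => z; rewrite mulrC.
  apply: measurable_fun_divr; [exact: rho_ge0| |exact: measurable_rho].
  by apply: continuous_measurable_grushin; exact: continuous_radial.
by apply: mpow; exact: measurable_rho.
Qed.

Let mF2 : measurable_fun setT (F2 : G -> R).
Proof.
apply: measurable_fun_divr.
- by move=> z; rewrite mulr_ge0// powR_ge0.
- by apply: measurable_funM; apply: mpow => //; exact: mnorm.
- by apply: measurable_funM; apply: mpow => //; exact: measurable_rho.
Qed.

Let mF3 r : measurable_fun setT (F3 r : G -> R).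
Proof.
apply: measurable_funM; last exact: mpow.
apply: measurable_fun_divr.
- by move=> z; rewrite !mulr_ge0// powR_ge0.
- apply: mpow; apply: mnorm; apply: measurable_funB => //.
  apply: measurable_funM; first by apply: measurable_funM => //; exact: mpow.
  have mc : measurable_fun setT (fun z : G => (expR (- r^-1) / rho z, z)).
    apply: measurable_fun_pair => //; apply: measurable_fun_divr => //.
      exact: rho_ge0.
    exact: measurable_rho.
  exact: measurableT_comp mu_ (measurableT_comp measurable_dil mc).
- apply: measurable_funM; last by apply: mpow; apply: mnorm; apply: measurableT_comp => //; exact: measurable_funM.
  by apply: measurable_funM; apply: mpow => //; exact: measurable_rho.
Qed.

Let F1_ge0 z : 0 <= F1 z. Proof. by rewrite divr_ge0 ?powR_ge0. Qed.
Let F2_ge0 z : 0 <= F2 z. Proof. by rewrite divr_ge0 ?mulr_ge0 ?powR_ge0. Qed.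
Let F3_ge0 r z : 0 <= F3 r z.
Proof. by rewrite mulr_ge0 ?divr_ge0 ?mulr_ge0 ?powR_ge0. Qed.

Let mball : measurable (gauge_ball 1 : set G).
Proof. exact: measurable_gauge_ball. Qed.

(** On a ray with [rho w = 1] the unit ball is the half-line [s > 0]. *)
Let integral_ray (F : G -> R) (H : R -> R) w : rho w = 1 ->
  (forall s, 0 < s -> expR (- s) ^+ n.+2 * F (dil (expR (- s)) w) = H s) ->
  (\int[lebesgue_measure]_s ((expR (- s) ^+ n.+2)%:E *
     ((EFin \o F) \_ (gauge_ball 1)) (dil (expR (- s)) w)) =
   \int[lebesgue_measure]_(s in `]0%R, +oo[) (H s)%:E)%E.
Proof.
move=> w1 FH; rewrite [RHS]integral_mkcond; apply: eq_integral => s _.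
rewrite /patch; have sE : (dil (expR (- s)) w \in gauge_ball 1) = (s \in [set` `]0%R, +oo[]).
  apply/idP/idP; rewrite !inE /gauge_ball/= rho_dil ?expR_ge0// w1 mulr1 -expR0 ltr_expR;
    by rewrite in_itv/= andbT oppr_lt0.
rewrite sE; case: ifPn => [|_]; last by rewrite mule0.
by rewrite inE/= in_itv/= andbT => s0; rewrite -EFinM FH.
Qed.

Let ray_facts w s : rho w = 1 -> 0 < s ->
  [/\ rho (dil (expR (- s)) w) = expR (- s),
      ln (rho (dil (expR (- s)) w))^-1 = s,
      psi (dil (expR (- s)) w) = psi w &
      expR (- s) ^+ n.+2 = expR (- s) `^ Q].
Proof.
move=> w1 s0; have e0 := expR_gt0 (- s).
have r1 : rho (dil (expR (- s)) w) = expR (- s) by rewrite rho_dil ?ltW// w1 mulr1.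
split => //.
- by rewrite r1 -expRN opprK expRK.
- rewrite /psi r1 /= enormZ ?ltW// w1 exprMn; field; exact: lt0r_neq0.
- rewrite -powR_mulrn ?ltW// /Q /hom_dim -natrD addn2//.
Qed.

Let kappa w := Num.sqrt (psi w) `^ p.

Let le_F23_F1 r : 0 < r ->
  (exists2 b, 0 < b < 1 & forall z, b <= rho z -> u z = 0) ->
  (\int[mu]_(z in gauge_ball 1) (k `^ p * F2 z + cp p * k `^ p * F3 r z)%:E <=
   \int[mu]_(z in gauge_ball 1) (F1 z)%:E)%E.
Proof.
move=> r0 [b b01 ub].
rewrite integral_mkcond [leRHS]integral_mkcond.
pose F23 z := k `^ p * F2 z + cp p * k `^ p * F3 r z.
have ck0 : 0 <= cp p * k `^ p by apply: mulr_ge0; [exact: ltW (cp_gt0 p2)|exact: powR_ge0].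
have F23_ge0 z : 0 <= F23 z by rewrite addr_ge0// mulr_ge0 ?powR_ge0.
have pn0 : p != 0 by apply/eqP; move: p2; lra.
have mrestrict F : measurable_fun setT (F : G -> R) ->
    measurable_fun setT ((EFin \o F) \_ (gauge_ball 1 : set G)).
  move=> mF; apply/(measurable_restrictT _ mball); apply: measurable_funTS.
  exact/measurable_EFinP.
(* Division by zero gives [0], so [psi] and all integrands vanish at the origin, as
   [le_integral_rays] requires. *)
have psi0 : psi ((0, 0) : 'rV[R]_n * R) = 0 by rewrite /psi rho0 expr0n/= invr0 mulr0.
have sq0 : Num.sqrt (psi ((0, 0) : 'rV[R]_n * R)) `^ p = 0 by rewrite psi0 sqrtr0 powR0.
apply: (@le_integral_rays R n ((EFin \o F23) \_ (gauge_ball 1)) ((EFin \o F1) \_ (gauge_ball 1))).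
- apply: mrestrict; apply: measurable_funD; exact: measurable_funM.
- exact: mrestrict.
- by move=> z; rewrite /patch; case: ifP => // _; rewrite lee_fin.
- by move=> z; rewrite /patch; case: ifP => // _; rewrite lee_fin.
- rewrite /patch; case: ifP => // _; rewrite /= /F23 /F2 /F3 sq0.
  by rewrite !(mulr0, mul0r) addr0.
- rewrite /patch; case: ifP => // _; rewrite /= /F1 /radial_grad_norm psi0.
  by rewrite sqrtr0 mul0r powR0// mul0r.
move=> w w1.
pose g s := u (dil (expR (- s)) w); pose g' s := - radial u (dil (expR (- s)) w).
pose A s := `|g' s| `^ p.
pose B s := k `^ p * (`|g s| `^ p / s `^ p) + cp p * k `^ p *
  (`|g s - s `^ k * r `^ k * g r^-1| `^ p / (s `^ p * `|ln (r * s)| `^ p)).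
(* The weight [rho^-Q] cancels the Jacobian, and the rescaled argument of [u] becomes
   [dil (e^(-1/r)) w], whatever [s] is. For [F1] below, [rho^(p-Q)] and the factor [rho^-p] from
   [partial_rho] cancel it together. *)
rewrite (@integral_ray F23 (fun s => kappa w * B s) w w1); last first.
  move=> s s0; have [f1 f2 f3 f4] := ray_facts w1 s0.
  have eQ : expR (- s) `^ Q != 0 by rewrite gt_eqF// powR_gt0// expR_gt0.
  rewrite /F23 /F2 /F3 f2 f1 f3 f4 dilM mulfVK ?gt_eqF ?expR_gt0//.
  rewrite -/(g s) -/(g r^-1) -/(kappa w) /B.
  move: eQ; move: (_ `^ Q) => e e0.
  rewrite !invfM; move: (s `^ p)^-1 (`|ln (r * s)| `^ p)^-1 => i1 i2.
  by field.
rewrite (@integral_ray F1 (fun s => kappa w * A s) w w1); last first.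
  move=> s s0; have [f1 f2 f3 f4] := ray_facts w1 s0.
  have e0 := expR_gt0 (- s).
  rewrite /F1 /radial_grad_norm /partial_rho f1 f3 f4 -/(radial u _).
  rewrite powRM ?sqrtr_ge0// -/(kappa w) normrM powRM//.
  rewrite /A /g' normrN gtr0_norm ?invr_gt0// powR_invr ?ltW//.
  rewrite powRD ?(gt_eqF e0) ?implybT// powRN.
  have e1 : expR (- s) `^ Q != 0 by rewrite gt_eqF// powR_gt0.
  have e2 : expR (- s) `^ p != 0 by rewrite gt_eqF// powR_gt0.
  by field; rewrite e1 e2.
have du s : differentiable u (dil (expR (- s)) w) := su [::] _.
have dg s : is_derive s (1 : R) g (g' s) by exact: is_derive_ray.
have cg' : continuous g'.
  move=> s; have cr := continuous_comp (@continuous_dil R n w s)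
    (@continuous_radial R n u su (dil (expR (- s)) w)).
  exact: cvgN cr.
have kap0 : 0 <= kappa w by exact: powR_ge0.
case/andP: b01 => b0 b1.
have lb : 0 < - ln b by rewrite oppr_gt0 ln_lt0// b0.
have ga s : s <= - ln b -> g s = 0.
  move=> sb; apply: ub; rewrite rho_dil ?expR_ge0// w1 mulr1 -[b]lnK ?posrE//.
  by rewrite ler_expR lerNr.
exact: (@log_hardy_remainder R p r g g' p2 r0 dg cg' (kappa w) (- ln b) kap0 lb ga).
Qed.


Let grad_rhoE X Y z :
  X * grushin_grad_norm rho z `^ p / (rho z `^ Q * Y) =
  X * Num.sqrt (psi z) `^ p / (rho z `^ Q * Y).
Proof.
have [r0|r0] := eqVneq (rho z) 0.
  by rewrite r0 powR0 ?(gt_eqF Q0)// mul0r invr0 !mulr0.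
by rewrite grushin_grad_norm_rho// lt_neqAle eq_sym r0 rho_ge0.
Qed.

Let I2E : (\int[mu]_(z in gauge_ball 1)
    (`|u z| `^ p * grushin_grad_norm rho z `^ p /
      (rho z `^ Q * ln (rho z)^-1 `^ p))%:E =
  \int[mu]_(z in gauge_ball 1) (F2 z)%:E)%E.
Proof. by apply: eq_integral => z _; rewrite grad_rhoE. Qed.

Let dCE r : ((dC p u r `^ p) = \int[mu]_(z in gauge_ball 1) (F3 r z)%:E)%E.
Proof.
have pn0 : p != 0 by apply/eqP; move: p2; lra.
have powK (X : \bar R) : (0 <= X)%E -> ((X `^ p^-1) `^ p)%E = X.
  have pp : p^-1 * p = 1 by rewrite mulVf.
  by move=> X0; rewrite -(poweRrM X p^-1 p) pp poweRe1.
rewrite /dC powK; last first.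
  apply: integral_ge0 => z _; rewrite lee_fin.
  by rewrite mulr_ge0 ?divr_ge0 ?mulr_ge0 ?powR_ge0.
apply: eq_integral => z _; congr EFin.
have -> : ((expR (- r^-1) / rho z) *: z.1, expR (- (2 / r)) * (z.2 / rho z ^+ 2)) =
    dil (expR (- r^-1) / rho z) z.
  rewrite /dil; congr pair; rewrite exprMn exprVn -mulrA [z.2 / _]mulrC.
  by rewrite [in RHS]expr2 -expRD; congr (expR _ * _); ring.
have [r0|r0] := eqVneq (rho z) 0.
  have Qn0 : Q != 0 by rewrite (gt_eqF Q0).
  have rQ : rho z `^ Q = 0 by rewrite r0 (powR0 Qn0).
  rewrite /F3 rQ; move: (grushin_grad_norm rho z `^ p) => y.
  by rewrite !mul0r invr0 !mulr0 !mul0r.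
have z0 : 0 < rho z by rewrite lt_neqAle eq_sym r0 rho_ge0.
by rewrite (grushin_grad_norm_rho z0).
Qed.

Hypothesis tu : test_function (gauge_ball 1 `\` [set (0, 0)]) u.

(** The theorem subtracts this integral in the extended reals, so it has to be finite. On the
    support of [u] both [rho] and [ln (1 / rho)] are bounded below, which bounds [F2] on a ball of
    finite measure. *)
Let F2_lty : (\int[mu]_(z in gauge_ball 1) (F2 z)%:E < +oo)%E.
Proof.
have [a [b [M [a0 b01 rab uM]]]] := test_function_bounds tu.
pose K := M `^ p / (a `^ Q * ln b^-1 `^ p).
have p0 : 0 <= p by move: p2; lra.
have M0 : 0 <= M by exact: le_trans (uM (0, 0)).
case/andP: b01 => b0 b1.
have lnV_gt0 (c : R) : 0 < c -> c < 1 -> 0 < ln c^-1.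
  by move=> c0 c1; apply: ln_gt0; rewrite invf_gt1.
have lb : 0 < ln b^-1 := lnV_gt0 b b0 b1.
have den0 : 0 < a `^ Q * ln b^-1 `^ p by rewrite mulr_gt0 ?powR_gt0.
have pn0 : p != 0 by apply/eqP; move: p2; lra.
have K0 : 0 <= K by apply: divr_ge0; [exact: powR_ge0|exact: ltW].
have FK z : F2 z <= K.
  rewrite /F2; have [->|uz] := eqVneq (u z) 0.
    by rewrite normr0 (powR0 pn0) !mul0r; exact: K0.
  have /andP[az zb] := rab z uz; have z0 : 0 < rho z by exact: lt_le_trans az.
  have lnz : 0 < ln (rho z)^-1 := lnV_gt0 _ z0 (le_lt_trans zb b1).
  have psi1 : Num.sqrt (psi z) `^ p <= 1.
    rewrite [leRHS](_ : 1 = 1 `^ p); last by rewrite powR1.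
    have sq1 : Num.sqrt (psi z) <= 1.
      by rewrite -sqrtr1; apply: ler_wsqrtr; exact: psi_le1.
    apply: ge0_ler_powR; [exact: p0|exact: sqrtr_ge0|exact: ler01|exact: sq1].
  have uMp : `|u z| `^ p <= M `^ p.
    apply: ge0_ler_powR; [exact: p0|exact: normr_ge0|exact: M0|exact: uM].
  have aQ : a `^ Q <= rho z `^ Q.
    by apply: ge0_ler_powR; [exact: ltW|exact: ltW|exact: ltW|exact: az].
  have lnle : ln b^-1 `^ p <= ln (rho z)^-1 `^ p.
    apply: ge0_ler_powR; [exact: p0|exact: ltW|exact: ltW|].
    rewrite ler_ln ?posrE ?invr_gt0; [|exact: b0|exact: z0].
    by rewrite lef_pV2 ?posrE; [exact: zb|exact: b0|exact: z0].
  have den1 : a `^ Q * ln b^-1 `^ p <= rho z `^ Q * ln (rho z)^-1 `^ p.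
    by apply: ler_pM; [exact: powR_ge0|exact: powR_ge0|exact: aQ|exact: lnle].
  have den2 : 0 < rho z `^ Q * ln (rho z)^-1 `^ p by exact: lt_le_trans den1.
  have num1 : `|u z| `^ p * Num.sqrt (psi z) `^ p <= M `^ p.
    rewrite -[leRHS]mulr1; apply: ler_pM; [exact: powR_ge0|exact: powR_ge0|exact: uMp|exact: psi1].
  apply: ler_pM.
  - by apply: mulr_ge0; exact: powR_ge0.
  - by rewrite invr_ge0; exact: ltW den2.
  - exact: num1.
  - by rewrite lef_pV2 ?posrE; [exact: den1|exact: den2|exact: den0].
apply: (@le_lt_trans _ _ (\int[mu]_(z in gauge_ball 1) (cst K%:E z))%E).
  apply: ge0_le_integral.
  - exact: mball.
  - by move=> z _; rewrite lee_fin; exact: F2_ge0.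
  - by apply: measurable_funTS; apply/measurable_EFinP; exact: mF2.
  - exact: measurable_cst.
  - by move=> z _; rewrite /= lee_fin; exact: FK.
rewrite (integral_cst _ mball); apply: lte_mul_pinfty.
- by rewrite lee_fin; exact: K0.
- by [].
- exact: gauge_ball_lty.
Qed.

Let hardy_ineq r : 0 < r ->
  ((k `^ p)%:E * \int[mu]_(z in gauge_ball 1) (F2 z)%:E +
   (cp p * k `^ p)%:E * \int[mu]_(z in gauge_ball 1) (F3 r z)%:E <=
   \int[mu]_(z in gauge_ball 1) (F1 z)%:E)%E.
Proof.
move=> r0; have [a [b [M [a0 b01 rab uM]]]] := test_function_bounds tu.
have [b0 b1] := andP b01.
have ck0 : 0 <= cp p * k `^ p by apply: mulr_ge0; [exact: ltW (cp_gt0 p2)|exact: powR_ge0].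
have mE (F : G -> R) : measurable_fun setT F ->
    measurable_fun (gauge_ball 1 : set G) (fun z => (F z)%:E).
  by move=> mF; apply: measurable_funTS; exact/measurable_EFinP.
have ub : exists2 c, 0 < c < 1 & forall z, c <= rho z -> u z = 0.
  (* [u] may be nonzero at [rho = b]; any number strictly between [b] and [1] gives vanishing with a
     weak inequality. *)
  exists ((b + 1) / 2); first by apply/andP; split; lra.
  move=> z bz; apply/eqP/negPn/negP => /rab /andP[_ zb].
  by move: bz zb; lra.
apply: le_trans (le_F23_F1 r0 ub).
have Zl c (F : G -> R) : 0 <= c -> measurable_fun setT F -> (forall z, 0 <= F z) ->
    (\int[mu]_(z in gauge_ball 1) (c * F z)%:E =
     c%:E * \int[mu]_(z in gauge_ball 1) (F z)%:E)%E.
  move=> c0 mF F0; under eq_integral do rewrite EFinM.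
  apply: ge0_integralZl; [exact: mball|exact: mE| |by rewrite lee_fin].
  by move=> z _; rewrite lee_fin; exact: F0.
have kp0 : 0 <= k `^ p by exact: powR_ge0.
rewrite -(Zl _ F2 kp0 mF2 F2_ge0) -(Zl _ (F3 r) ck0 (mF3 r) (F3_ge0 r)).
rewrite -ge0_integralD.
- exact: lexx.
- exact: mball.
- by move=> z _; rewrite lee_fin; apply: mulr_ge0; [exact: kp0|exact: F2_ge0].
- by apply: mE; apply: measurable_funM; [exact: measurable_cst|exact: mF2].
- by move=> z _; rewrite lee_fin; apply: mulr_ge0; [exact: ck0|exact: F3_ge0].
- by apply: mE; apply: measurable_funM; [exact: measurable_cst|exact: mF3].
Qed.

Lemma grushin_radial_hardy :
  (\int[mu]_(z in gauge_ball 1) (F1 z)%:E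
   - (k `^ p)%:E * \int[mu]_(z in gauge_ball 1)
      (`|u z| `^ p * grushin_grad_norm rho z `^ p /
        (rho z `^ Q * ln (rho z)^-1 `^ p))%:E
   >= (cp p * k `^ p)%:E *
      ereal_sup [set (dC p u r `^ p)%E | r in [set r : R | (0 < r)%R]])%E.
Proof.
have k1 : 0 < k by apply: divr_gt0; move: p2; lra.
have kp0 : 0 < k `^ p by exact: powR_gt0.
have ck0 : 0 < cp p * k `^ p by exact: mulr_gt0 (cp_gt0 p2) kp0.
have I2fin : ((k `^ p)%:E * \int[mu]_(z in gauge_ball 1) (F2 z)%:E)%E \is a fin_num.
  apply: fin_numM; first by [].
  rewrite ge0_fin_numE; first exact: F2_lty.
  by apply: integral_ge0 => z _; rewrite lee_fin; exact: F2_ge0.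
(* Dividing by the positive constant turns the claim into an upper bound on a supremum, checked for
   each [r]; the finite subtrahend can then be moved across. *)
rewrite I2E -(lee_pdivlMl _ _ ck0); apply/ereal_supP => _ [r /= r0 <-].
rewrite (lee_pdivlMl _ _ ck0) dCE (leeBrDr _ _ I2fin) addeC.
exact: hardy_ineq.
Qed.

End radial_hardy.

Theorem theorem6p1 (R : realType) (p : R) (n : nat)
  (hp : 2 <= p) (hn : (1 <= n)%N)
  (u : 'rV[R]_n * R -> R)
  (hu : test_function (gauge_ball 1 `\` [set (0, 0)]) u) :
  (\int[lebesgue_grushin R n]_(z in gauge_ball 1)
      (radial_grad_norm u z `^ p / rho z `^ (hom_dim R n - p))%:E
   - (((p - 1) / p) `^ p)%:E *
     \int[lebesgue_grushin R n]_(z in gauge_ball 1)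
      (`|u z| `^ p * grushin_grad_norm rho z `^ p /
        (rho z `^ hom_dim R n * ln (rho z)^-1 `^ p))%:E
   >= (cp p * ((p - 1) / p) `^ p)%:E *
      ereal_sup [set (dC p u r `^ p)%E | r in [set r : R | (0 < r)%R]])%E.
Proof.
by have [su _ _] := hu; exact: grushin_radial_hardy.
Qed.
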